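(* With the notation and assumptions of the context, let $i\in\{1,\ldots,g\}$ and $n\in\mathbb{Z}_{>0}$. Suppose that $e_{ii}^{(k)}\in O_K^*$ for all $k\in\mathbb{Z}_{\ge0}$. Then there exists a finite extension $K'$ of $K$ such that, upon replacing $K$ by $K'$, $|T_{n,i}|=p^n$. Moreover, for any $\pi\in T_{n,i}\setminus\{0\}$ there exists $s\in\{1,\ldots,n\}$ such that $|\pi|=|p|^{1/(p^s-p^{s-1})}$, and for any $s\in\{1,\ldots,n\}$ the cardinality of the set $\{\pi\in T_{n,i} : |\pi|=|p|^{1/(p^s-p^{s-1})}\}$ is exactly $p^s-p^{s-1}$.
   Context: $p$ is a prime, $K$ a finite extension of $\mathbb{Q}_p$, $|\cdot|$ its absolute value (extended to finite extensions) with $|p|=1/p$, $O_K=\{|a|\le1\}$, $\mathcal{M}_K=\{|a|<1\}$. $K((\frac1T))$ is the field of series $\sum_{i\le n}v_iT^i$; the degree is the largest exponent with nonzero coefficient. $A\subset K((\frac1T))$ is a $K$-subalgebra with $A\cap K[[\frac1T]]=K$ and $g:=\dim_KK((\frac1T))/(A+K[[\frac1T]])<\infty$. Put $\underline{M}(A)=\{\deg v : 0\ne v\in A\}=\{s_1<s_2<\cdots\}\subset\mathbb{Z}_{\ge0}$ and $\mathbb{Z}_{\ge0}\setminus\underline{M}(A)=\{\mu_1<\cdots<\mu_g\}$. The standard basis of $A$ is the unique basis $v_i=\sum_jv_{ij}T^j$ with $v_i$ monic of degree $s_i$ and $v_{i,s_j}=0$ for $i>j\ge1$; $A$ is assumed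 strictly integral, i.e. all $v_{ij}\in O_K$. $d$ is an integer with $p\equiv1\bmod d$ and $d\ge\mu_g$, $\zeta_d\in\mathbb{Z}_p$ is a primitive $d$-th root of unity, and the automorphism $\delta:\sum a_nT^n\mapsto\sum a_n(\zeta_dT)^n$ of $K((\frac1T))$ is assumed to restrict to an automorphism of $A$. Let $O(A)$ be the set of elements of $A$ with coefficients in $O_K$; one has $O_K[[\frac1T]][T]=O(A)\oplus\frac1TO_K[[\frac1T]]\oplus\bigoplus_iO_KT^{\mu_i}$, and $\mathbf{e}^{(k)}=(e^{(k)}_{ij})\in M_g(O_K)$ is defined by $T^{\mu_jp^k}-\sum_ie^{(k)}_{ij}T^{\mu_i}\in O(A)\oplus\frac1TO_K[[\frac1T]]$; under the present assumptions it is diagonal. Put $l_i(X):=\sum_{k\ge0}\frac{e^{(k)}_{ii}}{p^k}X^{p^k}$ and $$T_{n,i}:=\{\pi\in\mathcal{M}_K : l_i(\pi)=0,\ |\pi|\le|p|^{1/(p^n-p^{n-1})}\}.$$ ''Replacing $K$ by $K'$'' means taking $\pi\in\mathcal{M}_{K'}$ in the definition of $T_{n,i}$, with $l_i$ unchanged. *)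

(* Defs.v *)
From mathcomp Require Import all_boot all_order all_algebra all_field.
From mathcomp Require Import all_classical all_reals all_analysis.

Set Implicit Arguments.
Unset Strict Implicit.
Unset Printing Implicit Defensive.

Import Order.TTheory GRing.Theory Num.Theory.
Import numFieldNormedType.Exports.

Local Open Scope classical_set_scope.
Local Open Scope ring_scope.

Record ultrametric_abs (R : realType) (F : fieldType) (abs : F -> R) : Prop := {
  abs_ge0 : forall x, 0 <= abs x;
  abs_eq0 : forall x, abs x = 0 <-> x = 0;
  absM : forall x y, abs (x * y) = abs x * abs y;
  abs_ultra : forall x y, abs (x + y) <= Num.max (abs x) (abs y)
}.

Definition abs_cvg (R : realType) (F : fieldType) (abs : F -> R)
    (u : nat -> F) (l : F) : Prop :=
  (fun n => abs (u n - l)) @ \oo --> (0 : R).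

Definition abs_cauchy (R : realType) (F : fieldType) (abs : F -> R)
    (u : nat -> F) : Prop :=
  forall eps : R, 0 < eps ->
    exists N : nat, forall m n : nat, (N <= m)%N -> (N <= n)%N ->
      abs (u m - u n) < eps.

(* (F, abs) is a completion of the rationals for the p-adic absolute value.
   This determines (F, abs) up to a unique isometric isomorphism. *)
Record is_Qp (R : realType) (p : nat) (F : fieldType) (abs : F -> R) : Prop := {
  Qp_abs : ultrametric_abs abs;
  Qp_padic : forall n : nat, (0 < n)%N -> abs n%:R = (p%:R ^+ logn p n)^-1;
  Qp_complete : forall u : nat -> F, abs_cauchy abs u ->
    exists l : F, abs_cvg abs u l;
  Qp_dense : forall (x : F) (eps : R), 0 < eps ->
    exists q : rat, abs (x - ratr q) < eps
}.

(* [fieldExtType] consists of finite-dimensional extensions; over a complete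
   base field the extension of the absolute value is unique. *)
Record abs_extension (R : realType) (F : fieldType) (abs : F -> R)
    (L : fieldExtType F) (absL : L -> R) : Prop := {
  ext_abs : ultrametric_abs absL;
  ext_eq : forall x : F, absL x%:A = abs x
}.

Section ValuationRing.
Variables (R : realType) (F : fieldType) (abs : F -> R).

Definition integers : set F := [set x | abs x <= 1].

Definition maximal_ideal : set F := [set x | abs x < 1].

Definition integer_units : set F :=
  [set x | integers x /\ exists2 y, integers y & x * y = 1].

End ValuationRing.

(* A series \sum_(i <= n) v_i T^i is encoded by its coefficient function
   v : int -> K; sums of series are pointwise sums of functions. *)
Section Laurent.
Variable K : fieldType.
Implicit Types (v w : int -> K) (A B : set (int -> K)).

Definition laurent : set (int -> K) :=
  [set v | exists n : int, forall i : int, n < i -> v i = 0].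

Definition power_series : set (int -> K) :=
  [set v | forall i : int, 0 < i -> v i = 0].

Definition scale_series (c : K) v : int -> K := fun i => c * v i.

(* [\sum_(i \in _)] is the sum over the support; for v and w in [laurent]
   only finitely many terms are nonzero. *)
Definition mul_series v w : int -> K :=
  fun m => \sum_(i \in [set: int]) (v i * w (m - i)).

Definition monomial (n : int) : int -> K := fun i => (i == n)%:R.

Definition const_series (c : K) : int -> K := scale_series c (monomial 0).

Definition has_degree v (n : int) : Prop :=
  v n != 0 /\ forall i : int, n < i -> v i = 0.

Record subalgebra A : Prop := {
  subalg_laurent : A `<=` laurent;
  subalg_one : A (const_series 1);
  subalg_add : forall v w, A v -> A w -> A (v + w);
  subalg_scale : forall (c : K) v, A v -> A (scale_series c v);
  subalg_mul : forall v w, A v -> A w -> A (mul_series v w)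
}.

Definition sum_set A B : set (int -> K) :=
  [set u | exists v w, [/\ A v, B w & u = v + w]].

(* dim (V / S) = g: the classes of w_0, ..., w_(g-1) form a basis of V / S. *)
Definition quotient_dim (V S : set (int -> K)) (g : nat) : Prop :=
  exists w : 'I_g -> int -> K,
    (forall j, V (w j)) /\
    forall v, V v -> exists! c : {ffun 'I_g -> K},
      S (v - \sum_(j < g) scale_series (c j) (w j)).

Definition degrees A : set int :=
  [set n | exists2 v, A v & has_degree v n].

(* The indices start at 0: s i and v i are s_{i+1} and v_{i+1}. *)
Record standard_basis A (s : nat -> nat) (v : nat -> int -> K) : Prop := {
  sb_increasing : forall i j : nat, (i < j)%N -> (s i < s j)%N;
  sb_degrees : degrees A = [set (s i)%:Z | i in [set: nat]];
  sb_mem : forall i, A (v i);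
  sb_free : forall (n : nat) (c : 'I_n -> K),
    \sum_(i < n) scale_series (c i) (v i) = 0 -> forall i, c i = 0;
  sb_span : forall a, A a -> exists (n : nat) (c : 'I_n -> K),
    a = \sum_(i < n) scale_series (c i) (v i);
  sb_degree : forall i, has_degree (v i) (s i)%:Z;
  sb_monic : forall i, v i (s i)%:Z = 1;
  sb_reduced : forall i j : nat, (j < i)%N -> v i (s j)%:Z = 0
}.

(* mu_1 < ... < mu_g are the nonnegative integers outside [degrees A]. *)
Definition gaps A (g : nat) (mu : 'I_g -> nat) : Prop :=
  (forall i j : 'I_g, (i < j)%N -> (mu i < mu j)%N) /\
  [set n : nat | ~ degrees A n%:Z] = [set mu i | i in [set: 'I_g]].

Definition delta (zeta : K) v : int -> K := fun n => v n * zeta ^ n.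

End Laurent.

Arguments laurent K _ : clear implicits.
Arguments power_series K _ : clear implicits.

Section Integral.
Variables (R : realType) (K : fieldType) (abs : K -> R).
Implicit Types A : set (int -> K).

Definition strictly_integral A : Prop :=
  exists (s : nat -> nat) (v : nat -> int -> K),
    standard_basis A s v /\ forall (i : nat) (j : int), integers abs (v i j).

Definition integral_part A : set (int -> K) :=
  [set v | A v /\ forall i : int, integers abs (v i)].

Definition integral_tail : set (int -> K) :=
  [set v | (forall i : int, integers abs (v i)) /\
           forall i : int, 0 <= i -> v i = 0].

(* The decomposition of O_K[[1/T]][T] as the direct sum of O(A), of
   1/T O_K[[1/T]] and of the lines O_K T^(mu_i) makes this e unique. *)
Definition frobenius_matrices (p : nat) A (g : nat) (mu : 'I_g -> nat)
    (e : nat -> 'M[K]_g) : Prop :=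
  forall k : nat,
    (forall i j, integers abs (e k i j)) /\
    forall j : 'I_g,
      sum_set (integral_part A) integral_tail
        (monomial K (mu j * p ^ k)%N%:Z
         - \sum_(i < g) scale_series (e k i j) (monomial K (mu i)%:Z)).

End Integral.

Section TorsionPoints.
Variables (R : realType) (p : nat) (K : fieldType).
Variables (L : fieldExtType K) (absL : L -> R).

(* The series \sum_k a_k / p^k X^(p^k) with coefficients in K takes the value
   y at x in L. *)
Definition log_value (a : nat -> K) (x y : L) : Prop :=
  abs_cvg absL
    (fun N => \sum_(k < N) (a k / p%:R ^+ k) *: x ^+ (p ^ k)%N) y.

Definition critical_radius (n : nat) : R :=
  absL p%:R `^ ((p ^ n - p ^ n.-1)%N%:R)^-1.

Definition torsion_points (a : nat -> K) (n : nat) : set L :=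
  [set x | [/\ maximal_ideal absL x, log_value a x 0 & absL x <= critical_radius n]].

End TorsionPoints.

(* Main.v *)
(** Only the units [a_k = e_ii^(k)] matter.  A partial sum [P] of
    [l(X) = \sum_k a_k / p^k X^(p^k)] splits over a finite extension [L] of [K],
    to which the absolute value extends and which is again complete.  The Newton
    polygon of [P] has vertices [(p^k, -k)], so [P] has exactly [p^s] roots of
    absolute value at most [r_s = |p|^(1/(p^s - p^(s-1)))] and [p^(s-1)] roots of
    absolute value less than [r_s]; they are simple because [P'] is a unit on the
    open unit disc.  When [P] is long enough, it differs from [l] by at most
    [|p|^2] on the disc of radius [r_n], and both [P] and [l] are perturbations
    of multiplication by [a_0] on balls of radius [|p|^2] in it, so Newton
    iteration gives a bijection between their zeros.  It preserves absolute
    values, since nonzero zeros have absolute value at least [r_1 > |p|^2]. *)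

Require Import Defs.
From mathcomp Require Import all_boot all_order all_algebra all_field.
From mathcomp Require Import all_classical all_reals all_analysis.
From mathcomp Require Import ring zify.

Set Implicit Arguments.
Unset Strict Implicit.
Unset Printing Implicit Defensive.

Import Order.TTheory GRing.Theory Num.Theory.
Import numFieldNormedType.Exports.

Local Open Scope classical_set_scope.
Local Open Scope ring_scope.

(** * Splitting fields *)

Lemma irreducible_factor (F : fieldType) (p : {poly F}) :
  (1 < size p)%N -> exists2 r, r %| p & irreducible_poly r.
Proof.
move=> p_gt1.
have [m] := ubnP (size p); elim: m p p_gt1 => // m IH p p_gt1 lt_p.
have [irr|] := pselect (irreducible_poly p); first by exists p.
move=> /not_andP[//|/existsNP[q /not_implyP[q1 /not_implyP[qp nqp]]]].
have p0 : p != 0 by rewrite -size_poly_gt0 ltnW.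
have q_gt1 : (1 < size q)%N.
  by rewrite ltn_neqAle eq_sym q1 size_poly_gt0 (dvdpN0 qp).
have lt_q : (size q < size p)%N.
  rewrite ltn_neqAle dvdp_leq// andbT.
  by apply/negP => /eqP E; apply: nqp; rewrite -dvdp_size_eqp // E.
have [r rq irr] := IH q q_gt1 (leq_trans lt_q lt_p).
by exists r => //; apply: dvdp_trans qp.
Qed.

Lemma splitting_extension (F : fieldType) (p : {poly F}) : p != 0 ->
  exists (L : fieldExtType F) (zs : seq L),
    map_poly (in_alg L) p %= \prod_(z <- zs) ('X - z%:P).
Proof.
have [m] := ubnP (size p); elim: m F p => // m IH F p lt_p p0.
have [Cp|C'p] := leqP (size p) 1.
  exists F^o, [::].
  by rewrite big_nil -size_poly_eq1 size_map_poly eqn_leq Cp size_poly_gt0.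
have [r rp irr] := irreducible_factor C'p.
have [K _ [x rx0 _]] := irredp_FAdjoin irr.
have /factor_theorem[q Dp] : root (map_poly (in_alg K) p) x.
  by rewrite -(divpK rp) rmorphM rootM rx0 orbT.
have Dszp : size p = size (q * ('X - x%:P)) by rewrite -Dp size_map_poly.
have q0 : q != 0.
  by move: p0; rewrite -size_poly_eq0 Dszp size_poly_eq0 mulf_eq0 => /norP[].
have [L [zs Dq]] : exists (L : fieldExtType K) (zs : seq L),
    map_poly (in_alg L) q %= \prod_(z <- zs) ('X - z%:P).
  apply: IH => //; move: lt_p.
  by rewrite Dszp size_mul ?polyXsubC_eq0// size_XsubC addn2.
exists (baseFieldType L), (x%:A :: zs).
rewrite (eq_map_poly (fun a : F => baseField_scaleE a 1)).
rewrite (map_poly_comp (in_alg L) (in_alg K)) Dp big_cons mulrC rmorphM /=.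
by rewrite rmorphB /= map_polyX map_polyC /= eqp_mull.
Qed.

(** * Extension of absolute values *)

Section UltrametricAbs.
Variables (R : realType) (F : fieldType) (abs : F -> R).
Hypothesis habs : ultrametric_abs abs.

Lemma uabs_ge0 x : 0 <= abs x. Proof. by case: habs. Qed.

Lemma uabs0 : abs 0 = 0. Proof. by apply/(abs_eq0 habs). Qed.

Lemma uabs_gt0 x : (0 < abs x) = (x != 0).
Proof.
rewrite lt_neqAle uabs_ge0 andbT eq_sym; congr (~~ _).
by apply/eqP/eqP => /(abs_eq0 habs).
Qed.

Lemma uabsM x y : abs (x * y) = abs x * abs y. Proof. by case: habs. Qed.

Lemma uabs1 : abs 1 = 1.
Proof.
have : abs 1 != 0 by rewrite gt_eqF// uabs_gt0 oner_neq0.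
by move=> /mulfI; apply; rewrite -uabsM !mulr1.
Qed.

Lemma uabsX x n : abs (x ^+ n) = abs x ^+ n.
Proof. by elim: n => [|n IH]; rewrite ?expr0 ?uabs1// !exprS uabsM IH. Qed.

Lemma uabsV x : abs x^-1 = (abs x)^-1.
Proof.
have [->|x0] := eqVneq x 0; first by rewrite invr0 uabs0 invr0.
apply: (mulfI (x := abs x)); first by rewrite gt_eqF// uabs_gt0.
by rewrite -uabsM !divff ?uabs1// gt_eqF// uabs_gt0.
Qed.

Lemma uabsN x : abs (- x) = abs x.
Proof.
suff E : abs (-1) = 1 by rewrite -mulN1r uabsM E mul1r.
have : abs (-1) ^+ 2 = 1 by rewrite -uabsX sqrrN expr1n uabs1.
by move/eqP; rewrite sqrp_eq1 ?uabs_ge0// => /eqP.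
Qed.

Lemma uabs_distC x y : abs (x - y) = abs (y - x).
Proof. by rewrite -uabsN opprB. Qed.

Lemma uabs_le_add x y m : abs x <= m -> abs y <= m -> abs (x + y) <= m.
Proof.
by move=> xm ym; apply: le_trans (abs_ultra habs x y) _; rewrite ge_max xm ym.
Qed.

Lemma uabs_lt_add x y m : abs x < m -> abs y < m -> abs (x + y) < m.
Proof.
by move=> xm ym; apply: le_lt_trans (abs_ultra habs x y) _; rewrite gt_max xm ym.
Qed.

Lemma uabs_le_sub x y m : abs x <= m -> abs y <= m -> abs (x - y) <= m.
Proof. by move=> xm ym; apply: uabs_le_add; rewrite ?uabsN. Qed.

Lemma uabs_le_sum (I : Type) (s : seq I) (P : pred I) (G : I -> F) m : 0 <= m ->
  (forall i, P i -> abs (G i) <= m) -> abs (\sum_(i <- s | P i) G i) <= m.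
Proof.
move=> m0 Gm; apply: (big_ind (fun x => abs x <= m)) => //.
  by rewrite uabs0.
by move=> x y; apply: uabs_le_add.
Qed.

Lemma uabs_dominant x y : abs y < abs x -> abs (x + y) = abs x.
Proof.
move=> yx; apply/eqP; rewrite eq_le uabs_le_add ?(ltW yx)//=.
rewrite leNgt; apply/negP => xyx.
have : abs ((x + y) - y) < abs x by apply: uabs_lt_add; rewrite ?uabsN.
by rewrite addrK ltxx.
Qed.

Lemma uabs_nat_le1 n : abs n%:R <= 1.
Proof.
elim: n => [|n IH]; first by rewrite uabs0.
by rewrite -natr1; apply: uabs_le_add; rewrite ?uabs1.
Qed.

End UltrametricAbs.

Lemma geometric_small (R : realType) (C m eps : R) :
  0 <= C -> 0 <= m -> m < 1 -> 0 < eps ->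
  exists N, forall n, (N <= n)%N -> C * m ^+ n < eps.
Proof.
move=> C0 m0 m1 eps0.
have : (fun n => C * m ^+ n) @ \oo --> (0 : R).
  by rewrite -(mulr0 C); apply: cvgMr; apply: cvg_expr; rewrite ger0_norm.
move=> /cvgr0Pnorm_lt /(_ eps eps0) [N _ H]; exists N => n /H /=.
by rewrite ger0_norm// mulr_ge0// exprn_ge0.
Qed.

Section ExtendAbs.
Variables (R : realType) (K : fieldType) (abs : K -> R).
Hypothesis habs : ultrametric_abs abs.
Variable L : fieldExtType K.
Implicit Types (f g : L -> R) (x y c : L).

Record algebra_norm f : Prop := {
  norm_ge0 : forall x, 0 <= f x;
  norm1 : f 1 = 1;
  normZ : forall a x, f (a *: x) = abs a * f x;
  normM : forall x y, f (x * y) <= f x * f y;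
  normD : forall x y, f (x + y) <= Num.max (f x) (f y)
}.

Definition minimal_norm f : Prop := algebra_norm f /\
  forall g, algebra_norm g -> (forall x, g x <= f x) -> forall x, f x <= g x.

Lemma le_inf_mul (A : set R) (X c : R) : A !=set0 -> 0 <= c ->
  (forall m, A m -> X <= m * c) -> X <= inf A * c.
Proof.
move=> [m0 Am0]; rewrite le_eqVlt => /predU1P[<- /(_ _ Am0)|c0 H].
  by rewrite !mulr0.
rewrite -ler_pdivrMr//; apply: lb_le_inf; first by exists m0.
by move=> m Am; rewrite ler_pdivrMr// H.
Qed.

Lemma algebra_norm_inf (S : L -> set R) :
  (forall x, S x !=set0) ->
  (forall x m, S x m -> 0 <= m) ->
  S 1 1 -> (forall m, S 1 m -> 1 <= m) ->
  (forall a x m, S x m -> S (a *: x) (abs a * m)) ->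
  (forall x y m n, S x m -> S y n -> S (x * y) (m * n)) ->
  (forall x y m n, S x m -> S y n -> S (x + y) (Num.max m n)) ->
  algebra_norm (fun x => inf (S x)).
Proof.
move=> S0 Sge0 S11 S1 SZ SM SD.
have lbS x : has_lbound (S x) by exists 0 => m /Sge0.
have infS x m : S x m -> inf (S x) <= m by move=> Sm; apply: ge_inf.
have inf0 x : 0 <= inf (S x) by apply: lb_le_inf => // m /Sge0.
have leZ a x : inf (S (a *: x)) <= abs a * inf (S x).
  rewrite mulrC; apply: le_inf_mul => //; first exact: uabs_ge0.
  by move=> m Sm; rewrite mulrC; apply/infS/SZ.
split=> //.
- by apply/eqP; rewrite eq_le infS//=; apply: lb_le_inf.
- move=> a x; apply/eqP; rewrite eq_le leZ/=.
  have [->|a0] := eqVneq a 0; first by rewrite uabs0// mul0r.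
  rewrite -ler_pdivlMl ?uabs_gt0//.
  by rewrite -{1}[x]scale1r -(mulVf a0) -scalerA -uabsV//; apply: leZ.
- move=> x y; apply: le_inf_mul => // m Sm.
  rewrite [m * _]mulrC; apply: le_inf_mul => //; first exact: Sge0 Sm.
  by move=> n Sn; rewrite [n * m]mulrC; apply/infS/SM.
- move=> x y; rewrite leNgt; apply/negP; rewrite gt_max => /andP[xl yl].
  have [m Sm ml] := inf_lt (S0 x) xl.
  have [n Sn nl] := inf_lt (S0 y) yl.
  have : Num.max m n < inf (S (x + y)) by rewrite gt_max ml nl.
  by rewrite ltNge infS//; apply: SD.
Qed.

Lemma norm0 f : algebra_norm f -> f 0 = 0.
Proof. by move=> nf; rewrite -(scale0r 0) (normZ nf) uabs0// mul0r. Qed.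

Lemma norm_gt0 f c : algebra_norm f -> c != 0 -> 0 < f c.
Proof.
move=> nf c0; rewrite lt_neqAle (norm_ge0 nf) andbT; apply/negP => /eqP fc.
have := normM nf c c^-1.
by rewrite divff// (norm1 nf) -fc mul0r ler10.
Qed.

Lemma norm_exp_le f c n : algebra_norm f -> f (c ^+ n) <= f c ^+ n.
Proof.
move=> nf; elim: n => [|n IH]; first by rewrite !expr0 (norm1 nf).
rewrite !exprS; apply: le_trans (normM nf _ _) _.
by rewrite ler_wpM2l// (norm_ge0 nf).
Qed.

Lemma norm_sum_le f (nf : algebra_norm f) (I : Type) (s : seq I) (P : pred I)
    (G : I -> L) m : 0 <= m ->
  (forall i, P i -> f (G i) <= m) -> f (\sum_(i <- s | P i) G i) <= m.
Proof.
move=> m0 Gm; apply: (big_ind (fun x => f x <= m)) => //.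
  by rewrite norm0.
by move=> x y fx fy; apply: le_trans (normD nf _ _) _; rewrite ge_max fx fy.
Qed.

Lemma algebra_norm_exists : exists f, algebra_norm f.
Proof.
pose n := \dim {:L}; pose b := vbasis {:L}.
pose M x (ij : 'I_n * 'I_n) := coord b ij.2 (x * b`_ij.1).
pose f x := \big[Num.max/0]_ij abs (M x ij).
have leM x ij : abs (M x ij) <= f x by apply: le_bigmax.
have f_le x m : 0 <= m -> (forall ij, abs (M x ij) <= m) -> f x <= m.
  by move=> m0 H; apply: bigmax_le.
have f0 x : 0 <= f x by apply: bigmax_ge_id.
have n0 : (0 < n)%N by rewrite /n adim_gt0.
have freeb : free b by apply: basis_free (vbasisP _).
exists f; split=> //.
- apply/eqP; rewrite eq_le; apply/andP; split.
    apply: f_le => // -[i j]; rewrite /M /= mul1r coord_free//.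
    by case: (_ == _); rewrite ?uabs0// ?uabs1.
  have i0 : 'I_n by exists 0%N.
  by rewrite -(uabs1 habs); move: (leM 1 (i0, i0)); rewrite /M /= mul1r coord_free// eqxx.
- have leZ a x : f (a *: x) <= abs a * f x.
    apply: f_le; first by rewrite mulr_ge0// uabs_ge0.
    move=> ij; rewrite /M -scalerAl linearZ /= uabsM// ler_wpM2l ?uabs_ge0//.
    exact: leM.
  move=> a x; apply/eqP; rewrite eq_le leZ/=.
  have [->|a0] := eqVneq a 0; first by rewrite uabs0// mul0r.
  rewrite -ler_pdivlMl ?uabs_gt0//.
  by rewrite -{1}[x]scale1r -(mulVf a0) -scalerA -uabsV//; apply: leZ.
- move=> x y; apply: f_le => [|[i j]]; first by rewrite mulr_ge0.
  have -> : M (x * y) (i, j) = \sum_k M y (i, k) * M x (k, j).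
    rewrite /M /= -mulrA; set z := y * _.
    rewrite {1}(coord_vbasis (memvf z)) mulr_sumr linear_sum /=.
    by apply: eq_bigr => k _; rewrite -scalerAr linearZ.
  apply: uabs_le_sum; rewrite ?mulr_ge0// => k _.
  by rewrite uabsM// mulrC ler_pM ?uabs_ge0.
- move=> x y; apply: f_le => [|ij]; first by rewrite le_max f0.
  rewrite /M mulrDl linearD /=; apply: le_trans (abs_ultra habs _ _) _.
  by rewrite ge_max !le_max !leM orbT.
Qed.

Lemma minimal_norm_exists : exists f, minimal_norm f.
Proof.
pose T := {f | algebra_norm f}.
pose r (s t : T) := `[< forall x, sval t x <= sval s x >].
have [] := @Zorn T r.
- by move=> t; apply/asboolP.
- move=> s t u /asboolP st /asboolP tu; apply/asboolP => x.
  exact: le_trans (tu x) (st x).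
- move=> [s hs] [t ht] /asboolP /= st /asboolP /= ts.
  have E : s = t by apply/funext => x; apply/eqP; rewrite eq_le st ts.
  by subst t; congr exist; apply: Prop_irrelevance.
- move=> A totA; have [[f0 Af0]|A0] := pselect (A !=set0); last first.
    have [f nf] := algebra_norm_exists.
    by exists (exist _ f nf) => s As; exfalso; apply: A0; exists s.
  pose S x : set R := [set m | exists2 f, A f & sval f x <= m].
  have Sinf x (f : T) : A f -> inf (S x) <= sval f x.
    move=> Af; apply: ge_inf; last by exists f.
    by exists 0 => m [[h nh] _] /=; apply: le_trans; apply: norm_ge0.
  have common (f g : T) : A f -> A g -> exists2 h, A h &
      forall x, sval h x <= sval f x /\ sval h x <= sval g x.
    move=> Af Ag; have [/asboolP H|/asboolP H] := totA f g Af Ag.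
      by exists g.
    by exists f.
  have nS : algebra_norm (fun x => inf (S x)).
    apply: algebra_norm_inf.
    - by move=> x; exists (sval f0 x), f0.
    - by move=> x m [[h nh] _] /=; apply: le_trans; apply: norm_ge0.
    - by exists f0 => //; rewrite (norm1 (svalP f0)).
    - by move=> m [f _]; rewrite (norm1 (svalP f)).
    - move=> a x m [f Af fm]; exists f => //.
      by rewrite (normZ (svalP f)) ler_wpM2l// uabs_ge0.
    - move=> x y m k [f Af fm] [g Ag gm]; have [h Ah hfg] := common f g Af Ag.
      exists h => //; apply: le_trans (normM (svalP h) _ _) _.
      have [h1 _] := hfg x; have [_ h2] := hfg y.
      apply: ler_pM; rewrite ?(norm_ge0 (svalP h))//.
        exact: le_trans h1 fm.
      exact: le_trans h2 gm.
    - move=> x y m k [f Af fm] [g Ag gm]; have [h Ah hfg] := common f g Af Ag.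
      exists h => //; apply: le_trans (normD (svalP h) _ _) _.
      have [h1 _] := hfg x; have [_ h2] := hfg y.
      by rewrite ge_max !le_max (le_trans h1 fm) (le_trans h2 gm) orbT.
  by exists (exist _ _ nS) => s As; apply/asboolP => x /=; apply: Sinf.
- move=> [f nf] fmin; exists f; split=> // g ng gf x.
  have : r (exist _ f nf) (exist _ g ng) by apply/asboolP.
  by move=> /fmin [->].
Qed.

Lemma root_exists (a : R) m : 0 < a -> (0 < m)%N ->
  exists2 rho : R, 0 < rho & rho ^+ m = a.
Proof.
move=> a0 m0; exists (a `^ m%:R^-1); first exact: powR_gt0.
by rewrite -powR_mulrn ?powR_ge0// -powRrM mulVf ?powRr1 ?ltW// pnatr_eq0 -lt0n.
Qed.

(* If f (c^m) < f c ^ m, pick rho < f c with rho^m = f (c^m); the norm induced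
   on L = L[X]/(X - c) by the Gauss norm of radius rho is strictly smaller
   than f at c, and it does not collapse because f is bounded by a constant
   multiple of it. *)
Lemma minimal_normX f c m : minimal_norm f -> f (c ^+ m) = f c ^+ m.
Proof.
move=> [nf fmin]; apply/eqP; rewrite eq_le norm_exp_le//= leNgt; apply/negP.
case: m => [|m] lt_m; first by move: lt_m; rewrite !expr0 (norm1 nf) ltxx.
have c0 : c != 0.
  apply/negP => /eqP c0; move: lt_m.
  by rewrite c0 expr0n /= (norm0 nf) expr0n /= ltxx.
have [rho rho0 rhoE] := root_exists (norm_gt0 nf (expf_neq0 m.+1 c0)) (ltn0Sn m).
have lt_rho : rho < f c.
  by rewrite -(ltr_pXn2r (ltn0Sn m)) ?nnegrE ?ltW ?(norm_gt0 nf c0)// rhoE.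
pose C := (f c / rho) ^+ m.+1.
have fcrho : 1 <= f c / rho by rewrite ler_pdivlMr// mul1r ltW.
have C0 : 0 <= C by rewrite exprn_ge0// (le_trans ler01).
have leC i : f (c ^+ i) <= C * rho ^+ i.
  rewrite (divn_eq i m.+1) exprD mulnC exprM.
  apply: le_trans (normM nf _ _) _.
  have H1 : f ((c ^+ m.+1) ^+ (i %/ m.+1)) <= rho ^+ (m.+1 * (i %/ m.+1)).
    by apply: le_trans (norm_exp_le _ _ nf) _; rewrite exprM rhoE.
  have H2 : f (c ^+ (i %% m.+1)) <= C * rho ^+ (i %% m.+1).
    apply: le_trans (norm_exp_le _ _ nf) _.
    rewrite -ler_pdivrMr ?exprn_gt0// -expr_div_n.
    by apply: ler_weXn2l => //; apply/ltnW/ltn_pmod.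
  rewrite exprD mulrCA; apply: ler_pM => //; exact: norm_ge0.
pose S x : set R := [set k | 0 <= k /\
  exists2 q : {poly L}, q.[c] = x & forall i, f q`_i * rho ^+ i <= k].
have SM x y k l : S x k -> S y l -> S (x * y) (k * l).
  move=> [k0 [q <- qk]] [l0 [q' <- ql]]; split; first exact: mulr_ge0.
  exists (q * q'); rewrite ?hornerM// => i.
  rewrite -ler_pdivlMr ?exprn_gt0// coefM.
  apply: (norm_sum_le nf) => [|j _].
    by rewrite divr_ge0 ?mulr_ge0// exprn_ge0// ltW.
  apply: le_trans (normM nf _ _) _; rewrite ler_pdivlMr ?exprn_gt0//.
  have -> : rho ^+ i = rho ^+ j * rho ^+ (i - j) by rewrite -exprD subnKC// -ltnS.
  rewrite mulrACA; apply: ler_pM => //; rewrite mulr_ge0 ?(norm_ge0 nf)//.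
    by rewrite exprn_ge0// ltW.
  by rewrite exprn_ge0// ltW.
have Sconst x : S x (f x).
  split; first exact: norm_ge0.
  exists x%:P; rewrite ?hornerC// => i; rewrite coefC.
  case: i => [|i] /=; first by rewrite expr0 mulr1.
  by rewrite (norm0 nf) mul0r (norm_ge0 nf).
have S_le x k : S x k -> f x <= C * k.
  move=> [k0 [q <- qk]]; rewrite horner_coef.
  apply: (norm_sum_le nf) => [|i _]; first by rewrite mulr_ge0.
  apply: le_trans (normM nf _ _) _.
  apply: le_trans (ler_wpM2l (norm_ge0 nf _) (leC i)) _.
  by rewrite mulrCA ler_wpM2l.
have S11 : S 1 1 by move: (Sconst 1); rewrite (norm1 nf).
have nS : algebra_norm (fun x => inf (S x)).
  apply: algebra_norm_inf => //.
  - by move=> x; exists (f x).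
  - by move=> x k [].
  - move=> k S1k; rewrite leNgt; apply/negP => k1.
    have Sk j : S 1 (k ^+ j).
      elim: j => [|j IH]; first by rewrite expr0.
      by rewrite exprS -[1]mulr1; apply: SM.
    have k0 : 0 <= k by case: S1k.
    have [N /(_ N (leqnn N))] := geometric_small C0 k0 k1 ltr01.
    by rewrite ltNge -{1}(norm1 nf) S_le.
  - move=> a x k [k0 [q <- qk]]; split; first by rewrite mulr_ge0// uabs_ge0.
    exists (a%:A *: q); first by rewrite hornerZ -scalerAl mul1r.
    move=> i; rewrite coefZ -scalerAl mul1r (normZ nf) -mulrA.
    by rewrite ler_wpM2l// uabs_ge0.
  - move=> x y k l [k0 [q <- qk]] [l0 [q' <- ql]]; split.
      by rewrite le_max k0.
    exists (q + q'); rewrite ?hornerD// => i.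
    rewrite coefD -ler_pdivlMr ?exprn_gt0//.
    apply: le_trans (normD nf _ _) _.
    rewrite ge_max !ler_pdivlMr ?exprn_gt0// !le_max qk ql orbT.
    by [].
have lbS x : has_lbound (S x) by exists 0 => k [].
have : f c <= inf (S c).
  apply: (fmin _ nS) => x; apply: ge_inf (Sconst x).
  exact: lbS.
apply/negP; rewrite -ltNge; apply: le_lt_trans lt_rho.
apply: ge_inf => //; split; first exact: ltW.
exists 'X; rewrite ?hornerX// => i; rewrite coefX.
case: eqP => [->|_]; first by rewrite (norm1 nf) expr1 mul1r.
by rewrite (norm0 nf) mul0r ltW.
Qed.

Lemma minimal_normM f x c : minimal_norm f -> f (x * c) = f x * f c.
Proof.
move=> mf; have [nf fmin] := mf.
have [->|c0] := eqVneq c 0; first by rewrite mulr0 (norm0 nf) mulr0.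
have fc0 := norm_gt0 nf c0.
apply/eqP; rewrite eq_le (normM nf)/= -ler_pdivlMr//.
pose S y : set R := [set m | 0 <= m /\ exists n, f (y * c ^+ n) <= m * f c ^+ n].
have Sge y m n : f (y * c ^+ n) <= m * f c ^+ n ->
    forall k, f (y * c ^+ (n + k)) <= m * f c ^+ (n + k).
  move=> H k; rewrite !exprD !mulrA; apply: le_trans (normM nf _ _) _.
  by rewrite (minimal_normX _ _ mf) ler_wpM2r// exprn_ge0// ltW.
have Sc y n : S y (f (y * c ^+ n) / f c ^+ n).
  split; first by rewrite divr_ge0 ?exprn_ge0 ?(norm_ge0 nf).
  by exists n; rewrite divfK// gt_eqF// exprn_gt0.
have Sf y : S y (f y) by have := Sc y 0%N; rewrite !expr0 mulr1 divr1.
have nS : algebra_norm (fun y => inf (S y)).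
  apply: algebra_norm_inf.
  - by move=> y; exists (f y).
  - by move=> y m [].
  - by have := Sf 1; rewrite (norm1 nf).
  - move=> m [_ [n]]; rewrite mul1r (minimal_normX _ _ mf).
    by rewrite ler_pMl// exprn_gt0.
  - move=> a y m [m0 [n H]]; split; first by rewrite mulr_ge0// uabs_ge0.
    by exists n; rewrite -scalerAl (normZ nf) -mulrA ler_wpM2l// uabs_ge0.
  - move=> y z m k [m0 [n H]] [k0 [l H']]; split; first exact: mulr_ge0.
    exists (n + l)%N; rewrite !exprD mulrACA; apply: le_trans (normM nf _ _) _.
    by rewrite mulrACA; apply: ler_pM => //; apply: norm_ge0.
  - move=> y z m k [m0 [n H]] [k0 [l H']]; split; first by rewrite le_max m0.
    exists (n + l)%N; rewrite mulrDl; apply: le_trans (normD nf _ _) _.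
    have H1 := Sge _ _ _ H l; have := Sge _ _ _ H' n; rewrite addnC => H2.
    rewrite ge_max; apply/andP; split.
      apply: le_trans H1 _; rewrite ler_wpM2r ?exprn_ge0 ?(norm_ge0 nf)//.
      by rewrite le_max lexx.
    apply: le_trans H2 _; rewrite ler_wpM2r ?exprn_ge0 ?(norm_ge0 nf)//.
    by rewrite le_max lexx orbT.
have lbS y : has_lbound (S y) by exists 0 => k [].
apply: le_trans (fmin _ nS _ x) _; first by move=> y; apply: ge_inf.
by apply: ge_inf => //; have := Sc x 1%N; rewrite !expr1.
Qed.

Theorem abs_extension_exists : exists absL : L -> R, abs_extension abs absL.
Proof.
have [f mf] := minimal_norm_exists; have [nf _] := mf.
exists f; split; last by move=> a; rewrite (normZ nf) (norm1 nf) mulr1.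
split.
- exact: norm_ge0.
- move=> x; split=> [fx|->]; last exact: norm0.
  by apply: contraPeq fx => /(norm_gt0 nf) fx; apply/eqP; rewrite gt_eqF.
- by move=> x y; apply: minimal_normM.
- exact: normD.
Qed.

End ExtendAbs.

(** * Completeness of finite extensions *)

Lemma abs_cvgP (R : realType) (F : fieldType) (abs : F -> R) (u : nat -> F) l :
  ultrametric_abs abs ->
  abs_cvg abs u l <-> forall eps, 0 < eps ->
    exists N, forall n, (N <= n)%N -> abs (u n - l) < eps.
Proof.
move=> habs; split=> [/cvgr0Pnorm_lt H eps /H [N _ HN]|H].
  by exists N => n /HN /=; rewrite ger0_norm// uabs_ge0.
apply/cvgr0Pnorm_lt => eps /H [N HN]; exists N => // n /= /HN.
by rewrite ger0_norm// uabs_ge0.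
Qed.

Definition abs_complete (R : realType) (F : fieldType) (abs : F -> R) : Prop :=
  forall u, abs_cauchy abs u -> exists l, abs_cvg abs u l.

Section Limits.
Variables (R : realType) (F : fieldType) (abs : F -> R).
Hypothesis habs : ultrametric_abs abs.

Lemma abs_cvg_le (u : nat -> F) l x m : abs_cvg abs u l ->
  (exists N, forall n, (N <= n)%N -> abs (u n - x) <= m) -> abs (l - x) <= m.
Proof.
move=> /(abs_cvgP _ _ habs) ul [N HN]; apply/ler_addgt0Pr => eps eps0.
have [M HM] := ul _ eps0.
have m0 : 0 <= m by apply: le_trans (HN N (leqnn N)); apply: uabs_ge0.
have -> : l - x = (u (maxn M N) - x) - (u (maxn M N) - l).
  by rewrite opprB [RHS]addrC addrA subrK.
apply: (uabs_le_sub habs).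
  by apply: le_trans (HN _ (leq_maxr _ _)) _; rewrite lerDl ltW.
by apply: le_trans (ltW (HM _ (leq_maxl _ _))) _; rewrite lerDr.
Qed.

Lemma abs_cauchy_steps (u : nat -> F) :
  (forall eps, 0 < eps ->
    exists N, forall n, (N <= n)%N -> abs (u n.+1 - u n) < eps) ->
  abs_cauchy abs u.
Proof.
move=> H eps eps0; have [N HN] := H _ eps0; exists N.
have HN' m : (N <= m)%N -> abs (u m - u N) < eps.
  elim: m => [|m IH]; first by rewrite leqn0 => /eqP ->; rewrite subrr uabs0.
  rewrite leq_eqVlt => /predU1P[<-|]; first by rewrite subrr uabs0.
  rewrite ltnS => Nm; rewrite -(subrK (u m) (u m.+1)) -addrA.
  by apply: (uabs_lt_add habs); [apply: HN|apply: IH].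
move=> m n Nm Nn; rewrite -(subrK (u N) (u m)) -addrA.
by apply: (uabs_lt_add habs); [apply: HN'|rewrite uabs_distC//; apply: HN'].
Qed.

Hypothesis cpl : abs_complete abs.

Lemma contraction_zero (f : F -> F) (u x0 : F) (theta rho : R) :
  0 <= theta -> theta < 1 -> abs u = 1 ->
  (forall x y, abs (x - x0) <= rho -> abs (y - x0) <= rho ->
    abs (f x - f y - u * (x - y)) <= theta * abs (x - y)) ->
  abs (f x0) <= rho ->
  exists x, abs (x - x0) <= rho /\ f x = 0.
Proof.
move=> th0 th1 u1 hf fx0.
have rho0 : 0 <= rho by apply: le_trans fx0; apply: uabs_ge0.
have u0 : u != 0 by rewrite -(uabs_gt0 habs) u1.
pose step x := x - f x / u.
have stepE x : abs (step x - x) = abs (f x).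
  by rewrite /step addrAC subrr add0r uabsN// uabsM// uabsV// u1 invr1 mulr1.
pose x_ n := iter n step x0.
have xS n : x_ n.+1 = step (x_ n) by [].
have IHx n : abs (x_ n - x0) <= rho /\ abs (f (x_ n)) <= rho * theta ^+ n.
  elim: n => [|n [IH1 IH2]]; first by rewrite subrr uabs0// expr0 mulr1.
  have fn : abs (f (x_ n)) <= rho.
    by apply: le_trans IH2 _; rewrite ler_piMr// exprn_ile1// ltW.
  have H1 : abs (x_ n.+1 - x0) <= rho.
    rewrite -(subrK (x_ n) (x_ n.+1)) -addrA.
    by apply: (uabs_le_add habs) => //; rewrite xS stepE.
  split=> //; have := hf _ _ H1 IH1.
  have -> : f (x_ n.+1) - f (x_ n) - u * (x_ n.+1 - x_ n) = f (x_ n.+1).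
    have -> : x_ n.+1 - x_ n = - (f (x_ n) / u).
      by rewrite xS /step addrAC subrr add0r.
    by rewrite mulrN opprK [u * _]mulrC divfK// subrK.
  move=> H; apply: le_trans H _.
  by rewrite exprS mulrCA ler_wpM2l// xS stepE.
have [x xlim] : exists x, abs_cvg abs x_ x.
  apply: cpl; apply: abs_cauchy_steps => eps eps0.
  have [N HN] := geometric_small rho0 th0 th1 eps0.
  exists N => n /HN; apply: le_lt_trans; rewrite xS stepE; exact: (IHx n).2.
have xx0 : abs (x - x0) <= rho.
  by apply: (abs_cvg_le xlim); exists 0%N => n _; exact: (IHx n).1.
exists x; split=> //.
suff H eps : 0 < eps -> abs (f x) < eps.
  apply/(abs_eq0 habs); apply/eqP; rewrite eq_le uabs_ge0// andbT leNgt.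
  by apply/negP => /H; rewrite ltxx.
move=> eps0; have [N HN] := geometric_small rho0 th0 th1 eps0.
have /(_ _ eps0) [M HM] := (abs_cvgP _ _ habs).1 xlim.
pose n := maxn M N.
have fxn : abs (f (x_ n)) < eps.
  by apply: le_lt_trans (HN _ (leq_maxr M N)); exact: (IHx n).2.
have xn : abs (x - x_ n) < eps.
  by rewrite uabs_distC//; apply: HM; apply: leq_maxl.
have -> : f x = (f x - f (x_ n) - u * (x - x_ n)) + u * (x - x_ n) + f (x_ n).
  by rewrite !subrK.
do 2![apply: (uabs_lt_add habs) => //]; last by rewrite uabsM// u1 mul1r.
apply: le_lt_trans (hf _ _ xx0 (IHx n).1) _; apply: le_lt_trans xn.
by rewrite ler_piMl ?uabs_ge0// ltW.
Qed.

End Limits.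

Section CompleteExtension.
Variables (R : realType) (K : fieldType) (abs : K -> R).
Hypotheses (habs : ultrametric_abs abs) (cpl : abs_complete abs).
Variables (L : fieldExtType K) (absL : L -> R).
Hypothesis hL : abs_extension abs absL.

Let uL : ultrametric_abs absL := ext_abs hL.

Lemma ext_absZ a x : absL (a *: x) = abs a * absL x.
Proof. by rewrite -mulr_algl uabsM// (ext_eq hL). Qed.

Lemma span_complete (X : seq L) (u : nat -> L) :
  (forall n, u n \in <<X>>%VS) -> abs_cauchy absL u ->
  exists2 l, l \in <<X>>%VS & abs_cvg absL u l.
Proof.
elim: X u => [|e X IH] u us cu.
  exists 0; rewrite ?mem0v//; apply/abs_cvgP => // eps eps0; exists 0%N => n _.
  by have := us n; rewrite span_nil memv0 => /eqP ->; rewrite subrr uabs0.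
rewrite span_cons; have [es|es] := boolP (e \in <<X>>%VS).
  have E : (<[e]> + <<X>>)%VS = <<X>>%VS by apply/addv_idPr.
  by rewrite E; apply: IH => // n; rewrite -E -span_cons.
have [delta delta0 hdelta] : exists2 delta, 0 < delta &
    forall v, v \in <<X>>%VS -> delta <= absL (e - v).
  apply: contrapT => /forall2NP H; move/negP: es; apply.
  have /choice[v hv] (k : nat) :
      exists v, v \in <<X>>%VS /\ absL (v - e) < 2%:R^-1 ^+ k.
    have [/negP|/existsNP[v /not_implyP[vs /negP]]] := H (2%:R^-1 ^+ k).
      by rewrite exprn_gt0// invr_gt0 ltr0n.
    by rewrite -ltNge => ve; exists v; rewrite uabs_distC.
  have ve eps : 0 < eps ->
      exists N, forall n, (N <= n)%N -> absL (v n - e) < eps.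
    move=> eps0.
    have half0 : (0 : R) <= 2%:R^-1 by rewrite invr_ge0 ler0n.
    have half1 : (2%:R^-1 : R) < 1 by rewrite invf_lt1 ?ltr1n// ltr0n.
    have [N HN] := geometric_small ler01 half0 half1 eps0.
    by exists N => n /HN; rewrite mul1r; apply: lt_trans (hv n).2.
  have [|l ls lv] := IH v (fun n => (hv n).1).
    apply: abs_cauchy_steps => // eps eps0; have [N HN] := ve _ eps0.
    exists N => n Nn; rewrite -(subrK e (v n.+1)) -addrA.
    apply: (uabs_lt_add uL); first by apply: HN; apply: leqW.
    by rewrite uabs_distC//; apply: HN.
  suff -> : e = l by [].
  apply/esym/subr0_eq/(abs_eq0 uL)/eqP; rewrite eq_le uabs_ge0// andbT.
  apply/ler_addgt0Pr => eps eps0; rewrite add0r.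
  apply: (abs_cvg_le uL lv); have [N HN] := ve _ eps0.
  by exists N => n /HN /ltW.
have /choice[a /choice[v hav]] n :
    exists a v, v \in <<X>>%VS /\ u n = a *: e + v.
  have := us n; rewrite span_cons => /memv_addP[_ /vlineP[a ->] [v vs ->]].
  by exists a, v.
have le_a m n : abs (a m - a n) * delta <= absL (u m - u n).
  have [->|amn] := eqVneq (a m) (a n).
    by rewrite subrr uabs0// mul0r uabs_ge0.
  have {}amn : a m - a n != 0 by rewrite subr_eq0.
  have -> : u m - u n = (a m - a n) *: (e - (a m - a n)^-1 *: (v n - v m)).
    rewrite (hav m).2 (hav n).2 scalerBr scalerA divff// scale1r scalerBl.
    by rewrite opprB opprD addrACA.
  rewrite ext_absZ ler_wpM2l ?uabs_ge0//; apply: hdelta.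
  by rewrite memvZ// memvB ?(hav _).1.
have [al hal] : exists al, abs_cvg abs a al.
  apply: cpl => eps eps0.
  have [|N HN] := cu (eps * delta); first by rewrite mulr_gt0.
  exists N => m n Nm Nn; rewrite -(ltr_pM2r delta0).
  exact: le_lt_trans (le_a m n) (HN m n Nm Nn).
have ae eps : 0 < eps ->
    exists N, forall n, (N <= n)%N -> absL (a n *: e - al *: e) < eps.
  move=> eps0; have e0 : 0 < absL e.
    by rewrite uabs_gt0//; apply: contraNneq es => ->; rewrite mem0v.
  have [|N HN] := (abs_cvgP _ _ habs).1 hal (eps / absL e).
    by rewrite divr_gt0.
  exists N => n /HN; rewrite -scalerBl ext_absZ.
  by rewrite ltr_pdivlMr.
have vE n : v n = u n - a n *: e by rewrite (hav n).2 addrAC subrr add0r.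
have [|w ws hw] := IH v (fun n => (hav n).1).
  apply: abs_cauchy_steps => // eps eps0.
  have [N HN] := cu _ eps0; have [M HM] := ae _ eps0.
  exists (maxn N M) => n; rewrite geq_max => /andP[Nn Mn].
  have -> : v n.+1 - v n = u n.+1 - u n -
      (a n.+1 *: e - al *: e - (a n *: e - al *: e)).
    have -> : a n.+1 *: e - al *: e - (a n *: e - al *: e) = a n.+1 *: e - a n *: e.
      by rewrite opprB addrA subrK.
    by rewrite !vE !opprB addrACA [RHS]addrACA; congr (_ + _); apply: addrC.
  apply: (uabs_lt_add uL); first by apply: HN => //; apply: leqW.
  rewrite uabsN//; apply: (uabs_lt_add uL); first by apply: HM; apply: leqW.
  by rewrite uabsN//; apply: HM.
exists (al *: e + w); first by rewrite memv_add// memvZ// memv_line.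
apply/abs_cvgP => // eps eps0.
have [N HN] := (abs_cvgP _ _ uL).1 hw _ eps0; have [M HM] := ae _ eps0.
exists (maxn N M) => n; rewrite geq_max => /andP[Nn Mn].
rewrite (hav n).2 opprD addrACA.
by apply: (uabs_lt_add uL); [apply: HM|apply: HN].
Qed.

Theorem extension_complete : abs_complete absL.
Proof.
move=> u cu; have [|l _ hl] := @span_complete (vbasis {:L}) u _ cu.
  by move=> n; rewrite (span_basis (vbasisP _)) memvf.
by exists l.
Qed.

End CompleteExtension.

(** * Zeros of the series and of its partial sums *)

Section LogSeries.
Variables (R : realType) (F : fieldType) (abs : F -> R) (p : nat).
Hypotheses (habs : ultrametric_abs abs) (p_pr : prime p).
Local Notation absp := (abs p%:R).
Hypotheses (absp_gt0 : 0 < absp) (absp_lt1 : absp < 1).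
Variable a : nat -> F.
Hypothesis a_unit : forall k, abs (a k) = 1.

Definition log_sum N (x : F) : F :=
  \sum_(k < N) a k / p%:R ^+ k * x ^+ (p ^ k)%N.

Lemma abs_log_term k x : abs (a k / p%:R ^+ k * x ^+ (p ^ k)%N) =
  abs x ^+ (p ^ k)%N / absp ^+ k.
Proof. by rewrite !(uabsM habs) (uabsV habs) a_unit mul1r !(uabsX habs) mulrC. Qed.

Section Disc.
Variable theta : R.
Hypotheses (absp_theta : absp <= theta) (theta_lt1 : theta < 1).

Let theta_gt0 : 0 < theta. Proof. exact: lt_le_trans absp_theta. Qed.

Lemma abs_expp_sub x y : abs y <= theta -> abs (x - y) <= absp ^+ 2 ->
  abs (x ^+ p - y ^+ p) <= theta * absp * abs (x - y).
Proof.
move=> yt xy; set h := x - y; have -> : x = y + h by rewrite /h subrKC.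
have th : 0 <= theta * absp by rewrite mulr_ge0// ltW.
have pi1 : absp ^+ 2 <= 1 by rewrite exprn_ile1// ltW.
have h1 : abs h <= 1 by apply: le_trans xy pi1.
rewrite exprDn big_ord_recl /= subn0 expr0 mulr1 bin0 mulr1n addrAC subrr add0r.
apply: (uabs_le_sum habs) => [|[i ip] _] /=.
  by rewrite mulr_ge0// (uabs_ge0 habs).
rewrite /bump /= add1n -mulr_natl.
have [Ep|np] := eqVneq i.+1 p.
  rewrite Ep subnn expr0 mul1r binn mul1r (uabsX habs)//.
  have [q Eq] : exists q, p = q.+2 by case: p p_pr => [|[|q]] // _; exists q.
  rewrite Eq exprS mulrC ler_wpM2r ?(uabs_ge0 habs)// exprS -Eq.
  apply: (@le_trans _ _ (abs h)).
    by rewrite ler_piMr ?(uabs_ge0 habs)// exprn_ile1 ?(uabs_ge0 habs).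
  by apply: le_trans xy _; rewrite expr2 ler_wpM2r// ltW.
have i1p : (i.+1 < p)%N by rewrite ltn_neqAle np.
have /dvdnP[m ->] : (p %| 'C(p, i.+1))%N by rewrite prime_dvd_bin.
rewrite natrM !(uabsM habs)// exprS !(uabsM habs)// !(uabsX habs)//.
have -> : (p - i.+1 = (p - i.+1).-1.+1)%N by rewrite prednK// subn_gt0.
rewrite exprS.
have y1 : abs y <= 1 by apply: le_trans yt (ltW _).
have -> : abs m%:R * absp * (abs y * abs y ^+ (p - i.+1).-1 * (abs h * abs h ^+ i))
   = abs y * absp * abs h * (abs m%:R * (abs y ^+ (p - i.+1).-1 * abs h ^+ i)).
  by ring.
apply: (@le_trans _ _ (abs y * absp * abs h)).
  rewrite ler_piMr//; first by rewrite !mulr_ge0 ?(uabs_ge0 habs)// ltW.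
  by rewrite !mulr_ile1 ?mulr_ge0 ?exprn_ge0 ?(uabs_ge0 habs) ?(uabs_nat_le1 habs)
    ?exprn_ile1 ?(uabs_ge0 habs).
by rewrite !ler_wpM2r ?(uabs_ge0 habs).
Qed.

Lemma abs_exppk_sub k x y : abs y <= theta -> abs (x - y) <= absp ^+ 2 ->
  abs (x ^+ (p ^ k)%N - y ^+ (p ^ k)%N) <= (theta * absp) ^+ k * abs (x - y).
Proof.
move=> yt xy; elim: k => [|k IH]; first by rewrite expn0 !expr1 expr0 mul1r.
have tp : 0 <= theta * absp by rewrite mulr_ge0// ltW.
have tp1 : theta * absp <= 1 by rewrite mulr_ile1// ltW.
rewrite expnSr !exprM; apply: le_trans (abs_expp_sub _ _) _.
- rewrite (uabsX habs); apply: (le_trans _ yt).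
  rewrite -[leRHS]expr1 ler_wiXn2l ?(uabs_ge0 habs)//; first exact: le_trans yt (ltW _).
  by rewrite expn_gt0 prime_gt0.
- apply: le_trans IH _; apply: le_trans xy.
  by rewrite ler_piMl ?(uabs_ge0 habs)// exprn_ile1.
by rewrite exprS -[leRHS]mulrA ler_wpM2l.
Qed.

Lemma log_sum_sub N x y : abs y <= theta -> abs (x - y) <= absp ^+ 2 ->
  abs (log_sum N.+1 x - log_sum N.+1 y - a 0 * (x - y)) <= theta * abs (x - y).
Proof.
move=> yt xy; rewrite /log_sum !big_ord_recl /= expn0 expr0 !expr1 divr1.
set S := \sum_(i < N) _; set T := \sum_(i < N) _.
rewrite (_ : _ - _ - _ = S - T); last by ring.
rewrite -sumrB.
apply: (uabs_le_sum habs) => [|[k kN] _] /=.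
  by rewrite mulr_ge0 ?(uabs_ge0 habs)// ltW.
rewrite /bump /= add1n -mulrBr !(uabsM habs)// (uabsV habs)// a_unit mul1r (uabsX habs)//.
rewrite mulrC ler_pdivrMr ?exprn_gt0//.
apply: le_trans (abs_exppk_sub _ yt xy) _.
rewrite exprMn mulrAC ler_wpM2r ?exprn_ge0 ?(ltW absp_gt0)// ler_wpM2r ?(uabs_ge0 habs)//.
by rewrite exprS ler_piMr ?(ltW theta_gt0)// exprn_ile1// ltW.
Qed.

Lemma log_term_small eps : 0 < eps -> exists N, forall k, (N <= k)%N ->
  theta ^+ (p ^ k)%N / absp ^+ k < eps.
Proof.
move=> eps0; have th0 := ltW theta_gt0; have pi0 := ltW absp_gt0.
have p1 := prime_gt1 p_pr.
have [j Hj] := geometric_small ler01 th0 theta_lt1 (exprn_gt0 2 absp_gt0).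
have tj : theta ^+ (p ^ j)%N <= absp ^+ 2.
  by rewrite -[leLHS]mul1r ltW// Hj// ltnW// ltn_expl.
have tjk k : theta ^+ (p ^ (j + k))%N <= absp ^+ (2 * k.+1).
  elim: k => [|k IH]; first by rewrite addn0 muln1.
  rewrite addnS expnSr exprM; apply: (@le_trans _ _ ((absp ^+ (2 * k.+1)) ^+ p)).
    by rewrite lerXn2r ?nnegrE ?exprn_ge0.
  rewrite -exprM ler_wiXn2l ?(ltW absp_lt1)//.
  apply: (@leq_trans (2 * k.+1 * 2)); last by rewrite leq_mul2l p1 orbT.
  by rewrite -mulnA leq_mul2l /= mulnC mul2n -addnn addnS ltnS addSn ltnS leq_addl.
have C0 : 0 <= (absp ^+ j)^-1 by rewrite invr_ge0 exprn_ge0.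
have [N HN] := geometric_small C0 pi0 absp_lt1 eps0.
exists (j + N)%N => k jk; have jk' : (j <= k)%N by apply: leq_trans jk; apply: leq_addr.
rewrite -(subnKC jk'); set m := (k - j)%N.
apply: le_lt_trans (HN m _); last by rewrite /m leq_subRL.
rewrite ler_pdivrMr ?exprn_gt0// exprD mulrACA mulVf ?gt_eqF ?exprn_gt0// mul1r.
apply: le_trans (tjk m) _; rewrite -exprD ler_wiXn2l ?(ltW absp_lt1)//.
by rewrite mul2n -addnn addSn addnS !leqW.
Qed.

Lemma log_sum_cauchy x : abs x <= theta -> abs_cauchy abs (log_sum ^~ x).
Proof.
move=> xt; apply: abs_cauchy_steps => // eps eps0.
have [N HN] := log_term_small eps0; exists N => n /HN; apply: le_lt_trans.
rewrite /log_sum big_ord_recr /= addrAC subrr add0r abs_log_term.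
rewrite ler_wpM2r ?invr_ge0 ?exprn_ge0 ?(ltW absp_gt0)//.
by rewrite lerXn2r ?nnegrE ?(uabs_ge0 habs) ?(ltW theta_gt0).
Qed.

Lemma log_sum_tail N x l : abs x <= theta ->
  (forall k, (N <= k)%N -> theta ^+ (p ^ k)%N / absp ^+ k < absp ^+ 2) ->
  abs_cvg abs (log_sum ^~ x) l -> abs (l - log_sum N x) <= absp ^+ 2.
Proof.
move=> xt HN hl; apply: (abs_cvg_le habs hl); exists N.
elim=> [|n IH].
  by rewrite leqn0 => /eqP ->; rewrite subrr (uabs0 habs)// exprn_ge0// ltW.
rewrite leq_eqVlt => /predU1P[<-|]; first by rewrite subrr (uabs0 habs)// exprn_ge0// ltW.
rewrite ltnS => Nn; rewrite /log_sum big_ord_recr /= addrAC.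
apply: (uabs_le_add habs); first exact: IH.
rewrite abs_log_term; apply: le_trans (ltW (HN _ Nn)).
rewrite ler_wpM2r ?invr_ge0 ?exprn_ge0 ?(ltW absp_gt0)//.
by rewrite lerXn2r ?nnegrE ?(uabs_ge0 habs) ?(ltW theta_gt0).
Qed.

Lemma log_sub x y lx ly : abs y <= theta -> abs (x - y) <= absp ^+ 2 ->
  abs_cvg abs (log_sum ^~ x) lx -> abs_cvg abs (log_sum ^~ y) ly ->
  abs (lx - ly - a 0 * (x - y)) <= theta * abs (x - y).
Proof.
move=> yt xy /(abs_cvgP _ _ habs) hx /(abs_cvgP _ _ habs) hy.
have b0 : 0 <= theta * abs (x - y) by rewrite mulr_ge0 ?(uabs_ge0 habs)// ltW.
apply/ler_addgt0Pr => eps eps0.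
have [N HN] := hx _ eps0; have [M HM] := hy _ eps0.
pose n := (maxn N M).+1.
have -> : lx - ly - a 0 * (x - y) =
  (log_sum n x - log_sum n y - a 0 * (x - y)) -
  ((log_sum n x - lx) - (log_sum n y - ly)) by ring.
apply: (uabs_le_sub habs).
  by apply: le_trans (log_sum_sub _ yt xy) _; rewrite lerDl ltW.
apply: (@le_trans _ _ eps); last by rewrite lerDr.
apply: (uabs_le_sub habs); apply: ltW.
  by apply: HN; rewrite leqW// leq_maxl.
by apply: HM; rewrite leqW// leq_maxr.
Qed.

Lemma log_zeros_transfer (N : nat) : abs_complete abs ->
  (forall k, (N.+1 <= k)%N -> theta ^+ (p ^ k)%N / absp ^+ k < absp ^+ 2) ->
  exists phi : F -> F,
    [/\ forall x, abs x <= theta -> log_sum N.+1 x = 0 ->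
          abs (phi x - x) <= absp ^+ 2 /\ abs_cvg abs (log_sum ^~ (phi x)) 0,
        forall x y, abs x <= theta -> abs y <= theta ->
          log_sum N.+1 x = 0 -> log_sum N.+1 y = 0 -> phi x = phi y -> x = y &
        forall y, abs y <= theta -> abs_cvg abs (log_sum ^~ y) 0 ->
          exists x, [/\ abs x <= theta, log_sum N.+1 x = 0 & phi x = y]].
Proof.
move=> cpl HN; have th0 := ltW theta_gt0.
have pi2 : absp ^+ 2 <= theta.
  by apply: le_trans absp_theta; rewrite expr2 ler_piMr// ltW.
have near x y : abs y <= theta -> abs (x - y) <= absp ^+ 2 -> abs x <= theta.
  move=> yt xy; rewrite -(subrK y x); apply: (uabs_le_add habs) => //.
  exact: le_trans xy pi2.
have inj (x y z : F) : abs (z - a 0 * (x - y)) <= theta * abs (x - y) ->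
    z = 0 -> x = y.
  move=> + z0; rewrite z0 sub0r (uabsN habs)// (uabsM habs)// a_unit mul1r => H.
  apply/eqP; rewrite -subr_eq0 -[_ == 0]negbK -(uabs_gt0 habs) -leNgt.
  move: H; rewrite -subr_ge0 -{2}[abs (x - y)]mul1r -mulrBl => H.
  by move: H; rewrite nmulr_rge0// subr_lt0.
have /choice[l hl] (x : F) :
    exists y, abs x <= theta -> abs_cvg abs (log_sum ^~ x) y.
  have [xt|xt] := boolP (abs x <= theta); last by exists 0.
  by have [y] := cpl _ (log_sum_cauchy xt); exists y.
have uniq_cvg x u v : abs_cvg abs (log_sum ^~ x) u ->
    abs_cvg abs (log_sum ^~ x) v -> u = v.
  move=> hu hv; apply/subr0_eq/(abs_eq0 habs)/eqP.
  rewrite eq_le (uabs_ge0 habs)// andbT; apply/ler_addgt0Pr => eps eps0; rewrite add0r.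
  apply: (abs_cvg_le habs hu); have [M HM] := (abs_cvgP _ _ habs).1 hv _ eps0.
  by exists M => n /HM /ltW.
have newton (f : F -> F) x0 : abs x0 <= theta ->
    (forall x y, abs y <= theta -> abs (x - y) <= absp ^+ 2 ->
      abs (f x - f y - a 0 * (x - y)) <= theta * abs (x - y)) ->
    abs (f x0) <= absp ^+ 2 -> exists x, abs (x - x0) <= absp ^+ 2 /\ f x = 0.
  move=> x0t hf fx0; apply: (contraction_zero habs cpl th0 theta_lt1 (a_unit 0)) => //.
  move=> x y hx hy; apply: hf; first exact: near hy.
  have -> : x - y = (x - x0) - (y - x0) by ring.
  exact: (uabs_le_sub habs).
have l_sub x y : abs y <= theta -> abs (x - y) <= absp ^+ 2 ->
    abs (l x - l y - a 0 * (x - y)) <= theta * abs (x - y).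
  move=> yt xy; apply: log_sub => //; apply: hl => //; exact: near xy.
have close x : abs x <= theta -> abs (l x - log_sum N.+1 x) <= absp ^+ 2.
  by move=> xt; apply: log_sum_tail (hl x xt).
have /choice[phi hphi] (x : F) : exists y, abs x <= theta ->
    log_sum N.+1 x = 0 -> abs (y - x) <= absp ^+ 2 /\ l y = 0.
  have [[xt x0]|] := pselect (abs x <= theta /\ log_sum N.+1 x = 0); last first.
    by move=> H; exists 0 => ? ?; exfalso; apply: H.
  have [|y hy] := newton l x xt l_sub; last by exists y.
  by have := close x xt; rewrite x0 subr0.
exists phi; split.
- move=> x xt x0; have [h1 h2] := hphi x xt x0; split=> //.
  by rewrite -h2; apply: hl; apply: near h1.
- move=> x y xt yt x0 y0 E.
  apply: inj (log_sum_sub N yt _) _; last by rewrite x0 y0 subrr.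
  have -> : x - y = (phi y - y) - (phi x - x) by rewrite E; ring.
  by apply: (uabs_le_sub habs); [case: (hphi y yt y0)|case: (hphi x xt x0)].
- move=> y yt hy; have ly0 : l y = 0 by apply: uniq_cvg hy; apply: hl.
  have [|x [xy x0]] := newton (log_sum N.+1) y yt (@log_sum_sub N).
    by have := close y yt; rewrite ly0 sub0r (uabsN habs).
  have xt := near _ _ yt xy.
  have [h1 h2] := hphi x xt x0; exists x; split=> //.
  apply: inj (l_sub _ _ yt _) _; last by rewrite h2 ly0 subrr.
  by rewrite -(subrK x (phi x)) -addrA; apply: (uabs_le_add habs).
Qed.

End Disc.
End LogSeries.

(** * Newton polygon of the partial sums *)

Section DominantIndex.
Variables (R : realType) (F : fieldType) (abs : F -> R).
Hypothesis habs : ultrametric_abs abs.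
Implicit Types (q : {poly F}) (r : R).

(* [m] is the right end of the segment of slope [log r] of the Newton polygon. *)
Definition dominant_index q r (m : nat) : Prop := forall k : nat,
  abs q`_k * r ^+ k <= abs q`_m * r ^+ m /\
  ((m < k)%N -> abs q`_k * r ^+ k < abs q`_m * r ^+ m).

Lemma dominant_index_unique q r m m' :
  dominant_index q r m -> dominant_index q r m' -> m = m'.
Proof.
move=> hm hm'; have [lt|lt|//] := ltngtP m m'.
  by have [H _] := hm' m; have [_ /(_ lt)] := hm m'; rewrite ltNge H.
by have [H _] := hm m'; have [_ /(_ lt)] := hm' m; rewrite ltNge H.
Qed.

Lemma dominant_indexZ c q r m : c != 0 ->
  dominant_index q r m -> dominant_index (c *: q) r m.
Proof.
move=> c0 hm k; have [H1 H2] := hm k.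
rewrite !coefZ !(uabsM habs) -!mulrA ler_pM2l ?(uabs_gt0 habs)//.
by split=> // /H2; rewrite ltr_pM2l ?(uabs_gt0 habs).
Qed.

Lemma dominant_index_prod (zs : seq F) r : 0 < r ->
  dominant_index (\prod_(z <- zs) ('X - z%:P)) r (count (fun z => abs z <= r) zs).
Proof.
move=> r0; elim: zs => [|z zs IH].
  rewrite big_nil => k; rewrite /= !coef1 /= expr0 mulr1 (uabs1 habs).
  by case: k => [|k]; rewrite /= ?expr0 ?(uabs1 habs) ?mulr1 ?(uabs0 habs) ?mul0r.
rewrite big_cons /=; set Q := \prod_(_ <- _) _ in IH *; set m := count _ _ in IH *.
set M := abs Q`_m * r ^+ m in IH.
have M0 : 0 < M.
  have [_ /(_ (ltnSn m))] := IH m.+1; apply: le_lt_trans.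
  by rewrite mulr_ge0 ?(uabs_ge0 habs)// exprn_ge0// ltW.
have coefE k : (('X - z%:P) * Q)`_k.+1 = Q`_k - z * Q`_k.+1.
  by rewrite mulrBl coefB coefXM coefCM.
have coefE0 : (('X - z%:P) * Q)`_0 = - (z * Q`_0).
  by rewrite mulrBl coefB coefXM coefCM sub0r.
have shift k : abs Q`_k * r ^+ k.+1 = (abs Q`_k * r ^+ k) * r.
  by rewrite exprSr mulrA.
have rk k : 0 < r ^+ k by rewrite exprn_gt0.
have zk k : abs (z * Q`_k) * r ^+ k = abs z * (abs Q`_k * r ^+ k).
  by rewrite (uabsM habs) mulrA.
have az0 := uabs_ge0 habs z.
have [zr|zr] := boolP (abs z <= r); rewrite ?add1n ?add0n.
  have zkle k : abs (z * Q`_k) * r ^+ k <= M * r.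
    rewrite zk mulrC ler_pM// ?mulr_ge0 ?(uabs_ge0 habs) ?(ltW (rk k))//.
    by have [] := IH k.
  have zklt k : (m < k)%N -> abs (z * Q`_k) * r ^+ k < M * r.
    move=> mk; rewrite zk mulrC; apply: (@le_lt_trans _ _ (abs Q`_k * r ^+ k * r)).
      by rewrite ler_wpM2l// mulr_ge0 ?(uabs_ge0 habs) ?(ltW (rk k)).
    by rewrite ltr_pM2r//; have [_] := IH k; apply.
  have Em : abs (('X - z%:P) * Q)`_m.+1 * r ^+ m.+1 = M * r.
    rewrite coefE (uabs_dominant habs) ?shift// (uabsN habs).
    by rewrite -(ltr_pM2r (rk m.+1)) shift zklt.
  case=> [|k]; rewrite Em.
    by rewrite coefE0 (uabsN habs) zkle.
  rewrite coefE -ler_pdivlMr// -ltr_pdivlMr//; split=> [|mk].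
    apply: (uabs_le_sub habs); rewrite ler_pdivlMr// shift ler_pM2r//.
    by have [] := IH k.
  apply: (uabs_lt_add habs); rewrite ?(uabsN habs) ltr_pdivlMr//.
    by rewrite shift ltr_pM2r//; have [_] := IH k; apply.
  by apply: zklt; rewrite ltnW.
move: zr; rewrite -ltNge => zr.
have z0 : 0 < abs z by apply: lt_trans zr.
have kle k : abs Q`_k * r ^+ k.+1 < M * abs z.
  rewrite shift; apply: (@le_lt_trans _ _ (M * r)); last by rewrite ltr_pM2l.
  by rewrite ler_pM2r//; have [] := IH k.
have Em : abs (('X - z%:P) * Q)`_m * r ^+ m = M * abs z.
  case: m @M M0 kle {IH} => [|m] M M0 kle.
    by rewrite coefE0 (uabsN habs); apply: etrans (zk 0%N) (mulrC _ _).
  rewrite coefE addrC (uabs_dominant habs) (uabsN habs).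
    by rewrite zk mulrC.
  by rewrite -(ltr_pM2r (rk m.+1)) zk (mulrC (abs z)).
case=> [|k]; rewrite Em.
  rewrite coefE0 (uabsN habs) (zk 0%N) mulrC ler_pM2r//; split=> //.
  by have [] := IH 0%N.
rewrite coefE -ler_pdivlMr// -ltr_pdivlMr//; split=> [|mk].
  apply: (uabs_le_sub habs); rewrite ler_pdivlMr ?(ltW (kle k))//.
  by rewrite zk mulrC ler_pM2r//; have [] := IH k.+1.
apply: (uabs_lt_add habs); rewrite ?(uabsN habs) ltr_pdivlMr//.
by rewrite zk mulrC ltr_pM2r//; have [_] := IH k.+1; apply.
Qed.

End DominantIndex.

Lemma count_eq_sub (T : eqType) (a1 a2 : pred T) (s : seq T) :
  subpred a1 a2 -> count a1 s = count a2 s -> {in s, subpred a2 a1}.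
Proof.
move=> sub; elim: s => //= y s IH E; have := sub_count sub s => le_s.
have Ey : a1 y = a2 y.
  move: (sub y) E le_s; case: (a1 y); case: (a2 y) => //=; last by lia.
  by move=> /(_ isT).
move: E; rewrite Ey => /addnI /IH H z; rewrite inE => /predU1P[->|/H//].
by rewrite Ey.
Qed.

Section NewtonPolygon.
Variables (R : realType) (F : fieldType) (abs : F -> R) (p : nat).
Hypotheses (habs : ultrametric_abs abs) (p_pr : prime p).
Local Notation absp := (abs p%:R).
Hypotheses (absp_gt0 : 0 < absp) (absp_lt1 : absp < 1).
Variable a : nat -> F.
Hypothesis a_unit : forall k, abs (a k) = 1.

Local Notation gap k := (p ^ k - p ^ k.-1)%N.
Local Notation crit k := (absp `^ ((gap k)%:R)^-1).

Let p_neq0 : p%:R != 0 :> F. Proof. by rewrite -(uabs_gt0 habs). Qed.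

Lemma gapS k : gap k.+1 = (p ^ k * (p - 1))%N.
Proof. by rewrite /= expnSr mulnBr muln1. Qed.

Lemma gap_gt0 k : (0 < k)%N -> (0 < gap k)%N.
Proof.
case: k => // k _; rewrite gapS muln_gt0 expn_gt0 prime_gt0//.
by rewrite subn_gt0 prime_gt1.
Qed.

Lemma crit_gt0 k : 0 < crit k. Proof. exact: powR_gt0. Qed.

Lemma crit_exp k : (0 < k)%N -> crit k ^+ gap k = absp.
Proof.
move=> /gap_gt0 k0; rewrite -powR_mulrn ?powR_ge0// -powRrM mulVf ?powRr1 ?ltW//.
by rewrite pnatr_eq0 -lt0n.
Qed.

Lemma crit_le k r : (0 < k)%N -> 0 <= r -> (crit k <= r) = (absp <= r ^+ gap k).
Proof.
move=> k0 r0; rewrite -[in RHS](crit_exp k0) ler_pXn2r ?gap_gt0// nnegrE//.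
exact: powR_ge0.
Qed.

Lemma crit_lt k : (0 < k)%N -> crit k < crit k.+1.
Proof.
move=> k0; rewrite ltNge crit_le ?powR_ge0// -ltNge.
have -> : gap k.+1 = (gap k * p)%N.
  by case: k k0 => // k _; rewrite !gapS expnSr mulnAC.
rewrite exprM crit_exp// -[ltRHS]expr1.
by rewrite ltr_iXn2l// prime_gt1.
Qed.

Lemma crit_mono j k : (0 < j)%N -> (j <= k)%N -> crit j <= crit k.
Proof.
move=> j0 /subnKC <-; elim: (k - j)%N => [|m IH]; first by rewrite addn0.
by rewrite addnS; apply: le_trans IH (ltW _); rewrite crit_lt// addn_gt0 j0.
Qed.

Lemma crit_lt1 k : (0 < k)%N -> crit k < 1.
Proof.
move=> k0; rewrite ltNge; apply/negP => H.
have : 1 <= crit k ^+ gap k by rewrite exprn_ege1.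
by rewrite crit_exp// leNgt absp_lt1.
Qed.

Lemma crit1_ge : absp <= crit 1.
Proof.
rewrite leNgt; apply/negP => H.
have : crit 1 ^+ gap 1 < absp.
  apply: le_lt_trans H; rewrite -[leRHS]expr1 ler_wiXn2l ?powR_ge0//.
    by rewrite ltW// crit_lt1.
  exact: gap_gt0.
by rewrite crit_exp// ltxx.
Qed.

Definition log_poly N : {poly F} :=
  \sum_(k < N) (a k / p%:R ^+ k) *: 'X^(p ^ k).

Lemma horner_log_poly N x : (log_poly N).[x] = log_sum p a N x.
Proof.
by rewrite /log_poly horner_sum; apply: eq_bigr => k _; rewrite hornerZ hornerXn.
Qed.

Lemma coef_log_poly N k : (k < N)%N -> (log_poly N)`_(p ^ k) = a k / p%:R ^+ k.
Proof.
move=> kN; rewrite /log_poly coef_sum (bigD1 (Ordinal kN)) //= coefZ coefXn eqxx mulr1.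
rewrite big1 ?addr0// => j jk; rewrite coefZ coefXn eqn_exp2l ?prime_gt1//.
by rewrite eq_sym -[_ == _ :> nat]/(j == Ordinal kN) (negPf jk) mulr0.
Qed.

Lemma coef_log_poly0 N j : (forall k, (k < N)%N -> j != (p ^ k)%N) ->
  (log_poly N)`_j = 0.
Proof.
move=> H; rewrite /log_poly coef_sum big1// => k _.
by rewrite coefZ coefXn (negPf (H k (ltn_ord k))) mulr0.
Qed.

Lemma log_poly_dominant N s r : (s < N)%N -> 0 < r ->
  ((0 < s)%N -> crit s <= r) -> r < crit s.+1 ->
  dominant_index abs (log_poly N) r (p ^ s)%N.
Proof.
move=> sN r0 sr rs.
pose w k := r ^+ (p ^ k)%N / absp ^+ k.
have w0 k : 0 < w k by rewrite divr_gt0 ?exprn_gt0.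
have coefw k : (k < N)%N -> abs (log_poly N)`_(p ^ k)%N * r ^+ (p ^ k)%N = w k.
  move=> kN; rewrite coef_log_poly// (uabsM habs) (uabsV habs) a_unit mul1r.
  by rewrite (uabsX habs) mulrC.
have wS k : w k.+1 = w k * (r ^+ gap k.+1 / absp).
  have E : (p ^ k.+1 = p ^ k + gap k.+1)%N.
    by rewrite /= subnKC// leq_exp2l// prime_gt1.
  by rewrite /w {1}E exprD exprSr invfM mulrACA.
have w_le k : (w k <= w k.+1) = (crit k.+1 <= r).
  by rewrite wS ler_pMr// ler_pdivlMr// mul1r crit_le// ltW.
have w_up k : (k <= s)%N -> w k <= w s.
  move=> ks; have : crit s <= r \/ s = 0%N.
    by case: (posnP s) => [->|/sr]; [right|left].
  case=> [{}sr|s0]; last by move: ks; rewrite s0 leqn0 => /eqP ->.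
  rewrite -(subnKC ks); have : (k + (s - k) <= s)%N by rewrite subnKC.
  elim: (s - k)%N => [|m IH]; first by rewrite addn0.
  rewrite addnS => lt; apply: le_trans (IH (ltnW lt)) _.
  by rewrite w_le; apply: le_trans (crit_mono _ lt) sr.
have w_down k : (s < k)%N -> w k < w s.
  move=> sk; rewrite -(subnKC sk); elim: (k - s.+1)%N => [|m IH].
    by rewrite addn0 ltNge w_le -ltNge.
  rewrite addnS; apply: lt_trans IH.
  rewrite ltNge w_le -ltNge; apply: lt_le_trans rs (crit_mono _ _) => //.
  by rewrite -addnS leq_addr.
move=> j; rewrite coefw//.
have [[k [kN ->]]|H] := pselect (exists k, (k < N)%N /\ j = (p ^ k)%N).
  rewrite coefw// ltn_exp2l ?prime_gt1//; split; last exact: w_down.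
  by have [/w_up|/w_down/ltW] := leqP k s.
rewrite coef_log_poly0 ?(uabs0 habs) ?mul0r; first by split=> //; apply: ltW.
by move=> k kN; apply/eqP => jk; apply: H; exists k.
Qed.

Lemma log_poly_deriv N x : abs x < 1 -> (log_poly N.+1)^`().[x] != 0.
Proof.
move=> x1; rewrite /log_poly (raddf_sum (@deriv F)) horner_sum big_ord_recl /=.
have term k : ((a k / p%:R ^+ k) *: 'X^(p ^ k))^`().[x] = a k * x ^+ (p ^ k).-1.
  rewrite derivZ derivXn hornerZ hornerMn hornerXn -[_ *+ (p ^ k)%N]mulr_natr natrX.
  by rewrite -!mulrA; congr (_ * _); rewrite mulrCA mulVf ?mulr1// expf_neq0.
rewrite term expn0 expr0 mulr1 -(uabs_gt0 habs) (uabs_dominant habs) a_unit//.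
apply: (big_ind (fun y => abs y < 1)); first by rewrite (uabs0 habs).
  by move=> y z; apply: (uabs_lt_add habs).
move=> k _; rewrite term (uabsM habs) a_unit mul1r (uabsX habs).
rewrite exprn_ilt1 ?(uabs_ge0 habs)//= /bump /= add1n.
have : (1 < p ^ k.+1)%N by rewrite -(expn0 p) ltn_exp2l// prime_gt1.
by case: (p ^ k.+1)%N => [|[|]].
Qed.

Section Roots.
Variables (N : nat) (c : F) (zs : seq F).
Hypotheses (c_neq0 : c != 0)
  (splits : log_poly N.+1 = c *: \prod_(z <- zs) ('X - z%:P)).

Lemma mem_log_roots x : (x \in zs) = (log_sum p a N.+1 x == 0).
Proof.
rewrite -horner_log_poly splits hornerZ mulf_eq0 (negPf c_neq0) /=.
by rewrite -root_prod_XsubC rootE.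
Qed.

Lemma count_log_roots s r : (s <= N)%N -> 0 < r ->
  ((0 < s)%N -> crit s <= r) -> r < crit s.+1 ->
  count (fun z => abs z <= r) zs = (p ^ s)%N.
Proof.
move=> sN r0 sr rs; apply: (@dominant_index_unique _ _ abs (log_poly N.+1) r).
  by rewrite splits; apply: dominant_indexZ => //; apply: dominant_index_prod.
exact: log_poly_dominant.
Qed.

Lemma count_log_roots_le s : (0 < s <= N)%N ->
  count (fun z => abs z <= crit s) zs = (p ^ s)%N.
Proof.
by move=> /andP[s0 sN]; apply: count_log_roots => //; rewrite ?crit_gt0// crit_lt.
Qed.

Lemma count_log_roots_lt s : (0 < s <= N)%N ->
  count (fun z => abs z < crit s) zs = (p ^ s.-1)%N.
Proof.
move=> /andP[s0 sN].
pose r0 := if s == 1%N then crit s / 2%:R else crit s.-1.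
have [r00 r0s] : 0 < r0 /\ r0 < crit s.
  rewrite /r0; case: eqP => [_|s1]; rewrite ?crit_gt0; split=> //.
  - by rewrite divr_gt0// crit_gt0.
  - by rewrite ltr_pdivrMr// ltr_pMr ?crit_gt0// ltr1n.
  - have s2 : (0 < s.-1)%N by case: s s0 s1 {sN r0} => [|[]].
    by have := crit_lt s2; rewrite (prednK s0).
have [r [r0r rs hr]] : exists r, [/\ r0 <= r, r < crit s &
    {in zs, forall z, abs z < crit s -> abs z <= r}].
  elim: (zs) => [|z t [r [r0r rs hr]]]; first by exists r0.
  exists (if abs z < crit s then Num.max r (abs z) else r); split.
  - by case: ifP; rewrite ?le_max r0r.
  - by case: ifP => // zs'; rewrite gt_max rs zs'.
  - move=> y; rewrite inE => /predU1P[->|/hr H] ys.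
      by rewrite ys le_max lexx orbT.
    by case: ifP => _; rewrite ?le_max H.
apply: (etrans _ (@count_log_roots s.-1 r _ _ _ _)).
- apply: eq_in_count => z /hr H; apply/idP/idP => [/H//|zr].
  exact: le_lt_trans zr rs.
- by apply: leq_trans sN; apply: leq_pred.
- exact: lt_le_trans r0r.
- move=> s1; apply: le_trans r0r; rewrite /r0; case: eqP => // E.
  by move: s1; rewrite E.
- by rewrite prednK.
Qed.

Lemma count_log_roots_eq s : (0 < s <= N)%N ->
  count (fun z => abs z == crit s) zs = (p ^ s - p ^ s.-1)%N.
Proof.
move=> sN; apply: (canRL (addnK _)).
rewrite -[X in (_ + X)%N](count_log_roots_lt sN) -[RHS](count_log_roots_le sN).
elim: (zs) => //= z t <-; rewrite addnACA; congr addn.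
by rewrite le_eqVlt; case: ltgtP.
Qed.

Lemma uniq_log_roots : uniq [seq z <- zs | abs z < 1].
Proof.
apply: count_mem_uniq => x; rewrite mem_filter count_filter.
have [x1|x1] := boolP (abs x < 1); last first.
  rewrite (eq_count (a2 := pred0)) ?count_pred0// => y /=.
  by apply/negbTE/negP => /andP[/eqP -> H]; rewrite H in x1.
rewrite (eq_count (a2 := pred1 x)) /=; last first.
  by move=> y /=; case: eqP => [->|].
have [xs|xs] := boolP (x \in zs); last by apply/count_memPn.
apply/eqP; rewrite eqn_leq; apply/andP; split; last by rewrite -has_count has_pred1.
rewrite leqNgt; apply/negP => x2.
have /negP[] := log_poly_deriv N x1; apply/eqP.
have x2' : x \in rem x zs by rewrite -has_pred1 has_count count_rem xs /= eqxx subn_gt0.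
rewrite splits (perm_big _ (perm_to_rem xs)) big_cons.
rewrite (perm_big _ (perm_to_rem x2')) big_cons /=.
by rewrite derivZ !derivM !hornerE subrr !(mul0r, mulr0, addr0) /= !(mul0r, mulr0).
Qed.

Lemma log_root_abs x s : (0 < s <= N)%N -> x \in zs -> x != 0 -> abs x <= crit s ->
  exists2 t, (1 <= t <= s)%N & abs x = crit t.
Proof.
elim: s => // s IH /andP[_ sN] xs x0; rewrite le_eqVlt => /predU1P[->|xlt].
  by exists s.+1; rewrite ?leqnn.
have zs0 : 0 \in zs.
  rewrite mem_log_roots /log_sum big1// => k _.
  by rewrite expr0n expn_eq0 -leqn0 leqNgt prime_gt0// mulr0.
have Es : count (fun z => abs z < crit s.+1) zs = (p ^ s)%N.
  by rewrite count_log_roots_lt.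
case: s => [|s] in sN IH xlt Es *.
  exfalso; have {}Es : count (fun z => abs z < crit 1) zs = 1%N by [].
  pose S := [seq z <- zs | abs z < crit 1].
  have : (1 < size (undup S))%N.
    apply: (@leq_trans (size [:: x; 0])) => //; apply: uniq_leq_size.
      by rewrite /= inE x0.
    move=> y; rewrite !inE mem_undup mem_filter => /orP[]/eqP->.
      by rewrite xlt.
    by rewrite (uabs0 habs) crit_gt0.
  by rewrite ltnNge (leq_trans (size_undup _))// size_filter Es.
have sN' : (0 < s.+1 <= N)%N by rewrite (ltnW sN).
have sub z : abs z <= crit s.+1 -> abs z < crit s.+2.
  by move=> H; apply: le_lt_trans H (crit_lt _).
have xle : abs x <= crit s.+1.
  by apply: (count_eq_sub sub _ xs xlt); rewrite count_log_roots_le.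
have [t /andP[t0 ts] ->] := IH sN' xs x0 xle.
by exists t => //; rewrite t0 leqW.
Qed.

End Roots.
End NewtonPolygon.

(** * Torsion points *)

Lemma card_uniq_seq (F : fieldType) (s : seq F) :
  uniq s -> ([set x | x \in s] #= `I_(size s))%card.
Proof.
move=> us; have -> : [set x | x \in s] = nth 0 s @` `I_(size s).
  apply/seteqP; split=> [x /= /(nthP 0)[k ks <-]|_ [k /= ks <-]]; first by exists k.
  exact: mem_nth.
apply: inj_card_eq => j k; rewrite !inE /= => js ks /eqP.
by rewrite nth_uniq// => /eqP.
Qed.

Lemma card_image_uniq (F : fieldType) (phi : F -> F) (s : seq F) :
  uniq s -> {in s &, injective phi} ->
  (phi @` [set x | x \in s] #= `I_(size s))%card.
Proof.
move=> us inj; apply: card_eq_trans (card_uniq_seq us).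
by apply: inj_card_eq => x y; rewrite !inE; apply: inj.
Qed.

Lemma abs_integer_unit (R : realType) (F : fieldType) (abs : F -> R) x :
  ultrametric_abs abs -> integer_units abs x -> abs x = 1.
Proof.
move=> habs [x1 [y y1 xy]]; apply/eqP; rewrite eq_le [abs x <= 1]x1 /=.
rewrite -(uabs1 habs) -xy (uabsM habs) ler_piMr ?(uabs_ge0 habs)//.
Qed.

Lemma ext_abs_nat (R : realType) (F : fieldType) (abs : F -> R)
    (L : fieldExtType F) (absL : L -> R) m :
  abs_extension abs absL -> absL m%:R = abs m%:R.
Proof. by move=> h; rewrite -(ext_eq h) -(rmorph_nat (in_alg L)). Qed.

Lemma alg_div_nat (F : fieldType) (L : fieldExtType F) (x : F) m k :
  (x / m%:R ^+ k)%:A = x%:A / m%:R ^+ k :> L.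
Proof. by rewrite -[LHS]/(in_alg L _) fmorph_div rmorphXn rmorph_nat. Qed.

Lemma map_log_poly (F : fieldType) (L : fieldExtType F) p (a : nat -> F) N :
  map_poly (in_alg L) (log_poly p a N) = log_poly p (fun k => (a k)%:A) N.
Proof.
rewrite /log_poly rmorph_sum; apply: eq_bigr => k _ /=.
by rewrite map_polyZ map_polyXn; congr (_ *: _); apply: alg_div_nat.
Qed.

Lemma log_value_sum (R : realType) p (F : fieldType) (L : fieldExtType F)
    (absL : L -> R) (a : nat -> F) x y :
  log_value p absL a x y = abs_cvg absL (log_sum p (fun k => (a k)%:A) ^~ x) y.
Proof.
congr abs_cvg; apply/funext => N; apply: eq_bigr => k _.
by rewrite -alg_div_nat mulr_algl.
Qed.

Theorem torsion_points_count (R : realType) (p : nat) (p_pr : prime p)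
    (K : fieldType) (abs : K -> R) (habs : ultrametric_abs abs)
    (cpl : abs_complete abs) (absp_gt0 : 0 < abs p%:R) (absp_lt1 : abs p%:R < 1)
    (a : nat -> K) (a_unit : forall k, abs (a k) = 1) (n : nat) (n_gt0 : (0 < n)%N) :
  exists (L : fieldExtType K) (absL : L -> R),
    let T := torsion_points p absL a n in
    [/\ abs_extension abs absL,
        (T #= `I_(p ^ n)%N)%card,
        forall x : L, T x -> x <> 0 ->
          exists2 s : nat, (1 <= s <= n)%N & absL x = critical_radius p absL s
      & forall s : nat, (1 <= s <= n)%N ->
          ([set x | T x /\ absL x = critical_radius p absL s]
            #= `I_(p ^ s - p ^ s.-1)%N)%card].
Proof.
pose theta := abs p%:R `^ ((p ^ n - p ^ n.-1)%N%:R)^-1.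
have theta1 : theta < 1 := crit_lt1 p_pr absp_gt0 absp_lt1 n_gt0.
have absp_theta : abs p%:R <= theta.
  apply: le_trans (crit1_ge p_pr absp_gt0 absp_lt1) _.
  exact: (crit_mono p_pr absp_gt0 absp_lt1 (ltn0Sn 0) n_gt0).
have [N0 HN0] :=
  log_term_small p_pr absp_gt0 absp_lt1 absp_theta theta1 (exprn_gt0 2 absp_gt0).
pose N := maxn N0 n.
have nN : (n <= N)%N := leq_maxr _ _.
have P0 : log_poly p a N.+1 != 0.
  apply/eqP => P0; have := coef_log_poly p_pr a (ltn0Sn N).
  rewrite P0 coef0 expr0 divr1 => /esym a0.
  by have := a_unit 0%N; rewrite a0 (uabs0 habs) => /esym/eqP; rewrite oner_eq0.
have [L [zs]] := splitting_extension P0.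
rewrite map_log_poly => /eqpP[[c1 c2] /= /andP[c10 c20] E].
have splits : log_poly p (fun k => (a k)%:A) N.+1 =
    (c1^-1 * c2) *: \prod_(z <- zs) ('X - z%:P).
  by rewrite -scalerA -E scalerA mulVf// scale1r.
have c0 : c1^-1 * c2 != 0 by rewrite mulf_neq0// invr_eq0.
have [absL hL] := abs_extension_exists habs L.
have uL := ext_abs hL.
have piL : absL p%:R = abs p%:R := ext_abs_nat p hL.
have aL k : absL (a k)%:A = 1 by rewrite (ext_eq hL).
have cplL := extension_complete habs cpl hL.
exists L, absL; set T := torsion_points p absL a n.
have pi0 : 0 < absL p%:R by rewrite piL.
have pi1 : absL p%:R < 1 by rewrite piL.
have thetaE : theta = critical_radius p absL n by rewrite /critical_radius piL.
have crit1 : absL p%:R ^+ 2 < critical_radius p absL 1.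
  apply: lt_le_trans (crit1_ge p_pr pi0 pi1).
  by rewrite -[ltRHS]expr1 ltr_iXn2l.
pose tsum := log_sum p (fun k => (a k)%:A : L) N.+1.
have [||phi [phi_near phi_inj phi_surj]] :=
    log_zeros_transfer (N := N) uL p_pr pi0 pi1 aL (theta := theta) _ theta1 cplL.
- by rewrite piL.
- move=> k Nk; rewrite piL; apply: HN0; apply: leq_trans (ltnW Nk).
  exact: leq_maxl.
have mem_zs x : (x \in zs) = (tsum x == 0) := mem_log_roots c0 splits x.
pose Z := [seq z <- zs | absL z <= critical_radius p absL n].
have memZ z : (z \in Z) = (absL z <= theta) && (tsum z == 0).
  by rewrite mem_filter mem_zs thetaE.
have uniqZ : uniq Z.
  have := uniq_log_roots uL p_pr pi0 aL splits.
  move=> /(filter_uniq (fun z => absL z <= critical_radius p absL n)).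
  rewrite -filter_predI; congr (uniq _); apply: eq_filter => z /=.
  rewrite -thetaE andb_idr// => H; exact: le_lt_trans H theta1.
have root_abs z : z \in Z -> z != 0 ->
    exists2 t, (1 <= t <= n)%N & absL z = critical_radius p absL t.
  rewrite mem_filter => /andP[zn zs_z] z0.
  apply: (log_root_abs uL p_pr pi0 pi1 aL c0 splits _ zs_z z0 zn).
  by rewrite n_gt0.
have crit1_le z : z \in Z -> z != 0 -> absL p%:R ^+ 2 < absL z.
  move=> zZ /(root_abs z zZ)[t /andP[t0 _] ->]; apply: lt_le_trans crit1 _.
  exact: (crit_mono p_pr pi0 pi1 (ltn0Sn 0) t0).
have sum0 M : log_sum p (fun k => (a k)%:A : L) M 0 = 0.
  rewrite /log_sum big1// => k _.
  by rewrite expr0n expn_eq0 -leqn0 leqNgt prime_gt0// mulr0.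
have phi0 : phi 0 = 0.
  have [||x [xt x0 px]] := phi_surj 0.
  - by rewrite (uabs0 uL) powR_ge0.
  - apply/(abs_cvgP _ _ uL) => eps eps0; exists 0%N => k _.
    by rewrite sum0 subrr (uabs0 uL).
  have [x00|xn0] := eqVneq x 0; first by rewrite -[in LHS]x00.
  have [] := phi_near x xt x0; rewrite px sub0r (uabsN uL) leNgt.
  by rewrite crit1_le// memZ xt; apply/eqP.
have phi_abs z : z \in Z -> absL (phi z) = absL z.
  move=> zZ; have [->|z0] := eqVneq z 0; first by rewrite phi0.
  have := zZ; rewrite memZ => /andP[zt /eqP tz].
  have [H _] := phi_near z zt tz.
  rewrite -[phi z](subrK z) addrC (uabs_dominant uL)//.
  exact: le_lt_trans H (crit1_le z zZ z0).
have TE : T = phi @` [set z | z \in Z].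
  apply/seteqP; split=> [y [y1 yv yn]|_ [z /= zZ <-]].
    have [||x [xt x0 px]] := phi_surj y; rewrite ?thetaE -?log_value_sum//.
    by exists x => //=; rewrite memZ xt; apply/eqP.
  have := zZ; rewrite memZ => /andP[zt /eqP tz].
  have [_ H] := phi_near z zt tz; split.
  - by rewrite /maximal_ideal /= phi_abs//; apply: le_lt_trans zt _.
  - by rewrite log_value_sum.
  - by rewrite phi_abs// -thetaE.
have phi_injZ : {in Z &, injective phi}.
  move=> x y; rewrite !memZ => /andP[xt /eqP x0] /andP[yt /eqP y0].
  exact: phi_inj.
split=> //.
- rewrite TE; have -> : (p ^ n)%N = size Z; last exact: card_image_uniq.
  rewrite size_filter (count_log_roots_le uL p_pr pi0 pi1 aL c0 splits)//.
  by rewrite n_gt0.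
- move=> x; rewrite TE => -[z /= zZ <-] /eqP pz0.
  rewrite phi_abs//; apply: root_abs => //.
  by apply: contraNneq pz0 => ->; rewrite phi0.
move=> s /andP[s0 sn].
have -> : [set x | T x /\ absL x = critical_radius p absL s] =
    phi @` [set z | z \in [seq z <- Z | absL z == critical_radius p absL s]].
  apply/seteqP; split=> [x [+ xs]|_ [z /= + <-]].
    rewrite TE => -[z /= zZ zx]; exists z => //=.
    by rewrite mem_filter zZ -phi_abs// zx xs eqxx.
  rewrite mem_filter => /andP[/eqP zs' zZ]; split; last by rewrite phi_abs.
  by rewrite TE; exists z.
have -> : (p ^ s - p ^ s.-1)%N = size [seq z <- Z | absL z == critical_radius p absL s].
  rewrite size_filter count_filter.
  rewrite -(count_log_roots_eq uL p_pr pi0 pi1 aL c0 splits (s := s)).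
    apply: eq_count => z /=; case: eqP => //= ->; apply/esym.
    exact: (crit_mono p_pr pi0 pi1 s0 sn).
  by rewrite s0 (leq_trans sn).
apply: card_image_uniq; first exact: filter_uniq.
move=> x y; rewrite mem_filter => /andP[_ xZ].
by rewrite mem_filter => /andP[_ yZ]; apply: phi_injZ.
Qed.

Theorem proposition3p12 (R : realType) (p : nat) (p_prime : prime p)
    (Qp : fieldType) (absQp : Qp -> R) (hQp : is_Qp p absQp)
    (K : fieldExtType Qp) (abs : K -> R) (habs : abs_extension absQp abs)
    (A : set (int -> K)) (hA : subalgebra A)
    (hA0 : A `&` power_series K = [set const_series c | c in [set: K]])
    (g : nat)
    (hg : quotient_dim (laurent K) (sum_set A (power_series K)) g)
    (mu : 'I_g -> nat) (hmu : gaps A mu)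
    (hAint : strictly_integral abs A)
    (d : nat) (hdp : p = 1 %[mod d]) (hdmu : (\max_(j < g) mu j <= d)%N)
    (zeta : Qp) (hzeta_int : integers absQp zeta)
    (hzeta : d.-primitive_root zeta)
    (hdelta : [set delta (zeta%:A : K) v | v in A] = A)
    (e : nat -> 'M[K]_g) (he : frobenius_matrices abs p A mu e)
    (i : 'I_g) (n : nat) (hn : (0 < n)%N)
    (hunit : forall k : nat, integer_units abs (e k i i)) :
  exists (K' : fieldExtType K) (abs' : K' -> R),
    let T := torsion_points p abs' (fun k => e k i i) n in
    [/\ abs_extension abs abs',
        (T #= `I_(p ^ n)%N)%card,
        forall x : K', T x -> x <> 0 ->
          exists2 s : nat, (1 <= s <= n)%N & abs' x = critical_radius p abs' s
      & forall s : nat, (1 <= s <= n)%N ->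
          ([set x | T x /\ abs' x = critical_radius p abs' s]
            #= `I_(p ^ s - p ^ s.-1)%N)%card].
Proof.
have uK := ext_abs habs.
have cplK := extension_complete (Qp_abs hQp) (Qp_complete hQp) habs.
have pE : abs p%:R = p%:R^-1.
  rewrite (ext_abs_nat _ habs) (Qp_padic hQp) ?prime_gt0//.
  by rewrite logn_prime// eqxx expr1.
have p1 : 1 < p%:R :> R by rewrite ltr1n prime_gt1.
apply: torsion_points_count => //.
- by rewrite pE invr_gt0 ltr0n prime_gt0.
- by rewrite pE invf_lt1// (lt_trans ltr01).
- by move=> k; apply: abs_integer_unit.
Qed.
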